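(* Let $\Pi$ be a Boolean MDDLog program of diameter $k$. Then (1) if $\Pi$ is FO-rewritable, then it has a UCQ-rewriting in which each CQ has treewidth $(1,k)$; (2) if $\Pi$ is MDLog-rewritable, then it has an MDLog-rewriting of diameter $k$.
   Context: Instances are finite sets of facts over a schema. A Boolean MDDLog program over EDB schema $\mathbf{S}_E$ is a finite set of rules $S_1(\mathbf{x}_1)\vee\dots\vee S_m(\mathbf{x}_m)\leftarrow R_1(\mathbf{y}_1)\wedge\dots\wedge R_n(\mathbf{y}_n)$ ($n>0$, $m\ge0$, head variables occur in the body) with a distinguished nullary relation $\mathrm{goal}$ not occurring in bodies and only in rules with head $\mathrm{goal}()$, where relations occurring in heads (IDB) other than $\mathrm{goal}$ have arity $\le 1$ and other relations are in $\mathbf{S}_E$; $I\models\Pi$ iff $\Pi\cup I\models\mathrm{goal}()$. MDLog programs are MDDLog programs whose rule heads have exactly one atom. The diameter of a program is the maximum number of variables in a rule. A Boolean query $q$ is a rewriting of $\Pi$ if for all $\mathbf{S}_E$-instances $I$, $I\models q$ iff $I\models\Pi$; FO-rewritings are first-order sentences over $\mathbf{S}_E$ with equality and without constants; UCQ-rewritings are unions of Boolean conjunctive queries. A tree decomposition of an instance $I$ is a pair $(T,(B_v)_{v\in V})$ with $T=(V,E)$ an undirected tree and $B_v\subseteq\mathrm{adom}(I)$ such that for every $a\in\mathrm{adom}(I)$ the set $\{v\mid a\in B_v\}$ is nonempty and connected, and every fact of $I$ has all its constants in some $B_v$; it is an $(\ell,k)$-tree decomposition if $|B_v\cap B_{v'}|\le\ell$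 for all distinct $v,v'$ and $|B_v|\le k$ for all $v$. An instance has treewidth $(\ell,k)$ if it has an $(\ell,k)$-tree decomposition; a CQ has treewidth $(\ell,k)$ if the instance obtained from its atoms (variables as constants) does. *)

(* Defs.v *)
From mathcomp Require Import all_boot.
From Stdlib Require List.

Set Implicit Arguments.
Unset Strict Implicit.
Unset Printing Implicit Defensive.

(* Conventions:
   - EDB schema S_E: a finite type [E] of relation symbols with arities [ar].
   - Constants and variables are both natural numbers.
   - A fact is a pair (R, args); an S_E-instance is a finite list of facts of
     correct arity (a finite set of facts).
   - IDB relations of a program are unary ([BU]/[HU]) or nullary ([BN]/[HN]),
     named by naturals; [goal] is the distinguished nullary relation [HGoal],
     which syntactically cannot occur in rule bodies. *)

Section MDDLog.
Variable E : finType.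
Variable ar : E -> nat.

Definition fact := (E * seq nat)%type.
Definition instance := seq fact.

Definition inst_wf (I : instance) : Prop :=
  forall f, f \in I -> size f.2 = ar f.1.

Definition adom (I : instance) : seq nat := flatten [seq f.2 | f <- I].

Inductive batom :=
  | BE of E & seq nat
  | BU of nat & nat
  | BN of nat.

Inductive hatom :=
  | HU of nat & nat
  | HN of nat
  | HGoal.

Record rule := Rule { head : seq hatom; body : seq batom }.
Definition program := seq rule.

Definition batom_vars (a : batom) : seq nat :=
  match a with BE _ xs => xs | BU _ x => [:: x] | BN _ => [::] end.
Definition hatom_vars (h : hatom) : seq nat :=
  match h with HU _ x => [:: x] | _ => [::] end.

Definition body_vars (r : rule) : seq nat := flatten (map batom_vars (body r)).
Definition rule_vars (r : rule) : seq nat :=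
  undup (flatten (map hatom_vars (head r)) ++ body_vars r).

Definition diameter (Pi : program) : nat := \max_(r <- Pi) size (rule_vars r).

Definition wf_mddlog (Pi : program) : Prop :=
  forall r, List.In r Pi ->
    body r <> [::] /\
    (forall R xs, List.In (BE R xs) (body r) -> size xs = ar R) /\
    (forall p x, List.In (HU p x) (head r) -> x \in body_vars r) /\
    (List.In HGoal (head r) -> head r = [:: HGoal]) /\
    (* relations occurring in bodies but in no head are EDB: so every IDB
       relation used in a body occurs in some head *)
    (forall p x, List.In (BU p x) (body r) ->
       exists r' y, List.In r' Pi /\ List.In (HU p y) (head r')) /\
    (forall p, List.In (BN p) (body r) ->
       exists r', List.In r' Pi /\ List.In (HN p) (head r')).

Definition wf_mdlog (Pi : program) : Prop :=
  wf_mddlog Pi /\ forall r, List.In r Pi -> size (head r) = 1.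

Definition batom_holds (I : instance) (U : nat -> nat -> Prop) (N : nat -> Prop)
  (s : nat -> nat) (a : batom) : Prop :=
  match a with
  | BE R xs => (R, map s xs) \in I
  | BU p x => U p (s x)
  | BN p => N p
  end.

Definition hatom_holds (U : nat -> nat -> Prop) (N : nat -> Prop) (G : Prop)
  (s : nat -> nat) (h : hatom) : Prop :=
  match h with
  | HU p x => U p (s x)
  | HN p => N p
  | HGoal => G
  end.

Definition rule_sat I U N G (r : rule) : Prop :=
  forall s : nat -> nat,
    (forall a, List.In a (body r) -> batom_holds I U N s a) ->
    exists h, List.In h (head r) /\ hatom_holds U N G s h.

Definition prog_entails (I : instance) (Pi : program) : Prop :=
  forall (U : nat -> nat -> Prop) (N : nat -> Prop) (G : Prop),
    (forall r, List.In r Pi -> rule_sat I U N G r) -> G.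

Definition is_rewriting (q : instance -> Prop) (Pi : program) : Prop :=
  forall I, inst_wf I -> (q I <-> prog_entails I Pi).

Inductive fo :=
  | FEq of nat & nat
  | FAtom of E & seq nat
  | FNot of fo
  | FAnd of fo & fo
  | FEx of nat & fo.

Fixpoint fv (f : fo) : seq nat :=
  match f with
  | FEq x y => [:: x; y]
  | FAtom _ xs => xs
  | FNot g => fv g
  | FAnd g h => fv g ++ fv h
  | FEx x g => [seq y <- fv g | y != x]
  end.

Definition upd (s : nat -> nat) (x a : nat) : nat -> nat :=
  fun y => if y == x then a else s y.

Fixpoint fo_sat (I : instance) (s : nat -> nat) (f : fo) : Prop :=
  match f with
  | FEq x y => s x = s y
  | FAtom R xs => (R, map s xs) \in I
  | FNot g => ~ fo_sat I s g
  | FAnd g h => fo_sat I s g /\ fo_sat I s h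
  | FEx x g => exists a, a \in adom I /\ fo_sat I (upd s x a) g
  end.

Definition sentence_holds (f : fo) (I : instance) : Prop := fo_sat I (fun _ => 0) f.

Definition FO_rewritable (Pi : program) : Prop :=
  exists f : fo, fv f = [::] /\ is_rewriting (sentence_holds f) Pi.

Definition MDLog_rewritable (Pi : program) : Prop :=
  exists Pi' : program, wf_mdlog Pi' /\ is_rewriting (fun I => prog_entails I Pi') Pi.

(* a Boolean CQ: a list of atoms R(x1..xn) over variables (nat) *)
Definition cq := seq fact.
Definition ucq := seq cq.

Definition cq_wf (q : cq) : Prop := forall a, a \in q -> size a.2 = ar a.1.

Definition cq_holds (q : cq) (I : instance) : Prop :=
  exists s : nat -> nat, forall a, a \in q -> (a.1, map s a.2) \in I.

Definition ucq_holds (Q : ucq) (I : instance) : Prop :=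
  exists q, List.In q Q /\ cq_holds q I.

Definition is_tree (n : nat) (e : rel 'I_n) : Prop :=
  0 < n /\ irreflexive e /\ symmetric e /\
  (forall u v, connect e u v) /\
  (forall (x : 'I_n) (p : seq 'I_n),
      uniq (x :: p) -> 1 < size p -> path e x p -> ~~ e (last x p) x).

Definition tree_decomposition (I : instance) (n : nat) (e : rel 'I_n)
  (B : 'I_n -> seq nat) : Prop :=
  is_tree e /\
  (forall v, uniq (B v) /\ {subset B v <= adom I}) /\
  (forall a, a \in adom I ->
     (exists v, a \in B v) /\
     (forall u v, a \in B u -> a \in B v ->
        connect (fun x y => [&& e x y, a \in B x & a \in B y]) u v)) /\
  (forall f, f \in I -> exists v, {subset f.2 <= B v}).

Definition has_treewidth (l k : nat) (I : instance) : Prop :=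
  exists (n : nat) (e : rel 'I_n) (B : 'I_n -> seq nat),
    tree_decomposition I e B /\
    (forall u v, u != v -> size [seq a <- B u | a \in B v] <= l) /\
    (forall v, size (B v) <= k).

Definition cq_treewidth (l k : nat) (q : cq) : Prop := has_treewidth l k q.

End MDDLog.

(* Main.v *)
(* Feder and Vardi's sparse incomparability method.  By a partite amalgamation in
   the style of Nesetril and Rodl, every instance [I] admits a homomorphism from an
   instance [I'] of large girth, glued from copies of the restrictions of [I] to at
   most [k] elements, such that [I] and [I'] agree on programs of diameter [k].

   If [Pi] has an MDLog rewriting [P], a match of a rule body of [P] in [I'] spans a
   hyperforest of edges of size at most [k], so it can be evaluated by removing leaf
   edges one after the other; each removal is a rule with at most [k] variables whose
   head names the removed conjunctive query.

   If [Pi] has a first-order rewriting of quantifier rank [r], an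
   Ehrenfeucht-Fraisse game shows that the disjoint union of [I'] with many copies of
   its balls of radius [2 ^ r] cannot be told apart from the copies of the balls
   alone.  These balls are hypertrees of bounded depth, hence map into one of
   finitely many trees, determined by depth-bounded types, that map back to [I']. *)
From HB Require Import structures.
Require Import Defs.
From mathcomp Require Import all_boot.
From Stdlib Require List.
From Stdlib Require Import Classical ClassicalEpsilon.

Set Implicit Arguments.
Unset Strict Implicit.
Unset Printing Implicit Defensive.

(** * Hypergraphs of large girth *)

(** Large girth alone does not let a model on [I'] be carried back to [I]. The unary predicates of a
    model amount to a colouring of the elements by finitely many colours, so a Ramsey property is
    required: every colouring of [I'] induces one of [I] such that each set of at most [k] elements
    of [I] has a copy in [I'] with the same colours. A match of a rule of diameter at most [k] lifts
    to such a copy; this is where the arity of the IDB relations and the diameter enter. The girth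
    depends on the rewriting at hand. A Datalog body with [b] atoms touches at most [b] edges, so
    [b] is enough. For a first-order sentence of rank [r] and [R = 2 ^ r], the cycles to be excluded
    in a ball consist of two paths of at most [R] edges each and at most two more edges, whence
    [R.*2.+2]. Distinct edges of a hypertree share at most one element, and an edge has at most [k]
    of them: this is the origin of treewidth [(1,k)] and, on the Datalog side, the reason why a
    single unary or nullary name can replace a removed edge. *)

Definition decide (P : Prop) : bool :=
  if excluded_middle_informative P then true else false.

Lemma decideP (P : Prop) : reflect P (decide P).
Proof. by rewrite /decide; case: excluded_middle_informative => h; constructor. Qed.

Fixpoint seqs_upto (T : Type) (P : seq T) n : seq (seq T) :=
  if n is m.+1 then [::] :: [seq a :: l | a <- P, l <- seqs_upto P m] else [:: [::]].

Lemma mem_seqs_upto (T : eqType) (P : seq T) n (l : seq T) :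
  (l \in seqs_upto P n) = (size l <= n) && all [in P] l.
Proof.
elim: n l => [|n IH] [|a l] //=; rewrite inE /=.
apply/allpairsP/idP => [[[b m] /= [bP]]|].
  by rewrite IH ltnS => /andP[sm am] [-> ->]; rewrite sm bP am.
by rewrite ltnS => /and3P[sl aP al]; exists (a, l); rewrite IH sl al.
Qed.

Section Girth.
Variable V : eqType.
Implicit Types (F G : seq (seq V)) (e : seq V).

Definition touched F e v u := u = v \/ exists e', [/\ e' \in F, e' <> e & u \in e'].

(* No Berge cycle among at most [p] edges, stated as the existence of a leaf edge.
   The leaf can be chosen relative to a root [v], which makes the property stable
   under amalgamation. *)
Definition girth_gt p G := forall F v, uniq F -> {subset F <= G} ->
  F <> [::] -> size F <= p ->
  exists2 e, e \in F & forall u w, u \in e -> w \in e ->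
    touched F e v u -> touched F e v w -> u = w.

(** If the leaf found is [h0], it meets the other edges in at most one vertex [x]; a leaf of the
    remaining edges relative to the root [x] is then a leaf of all of [F]. *)
Lemma girth_gt_rooted p G F h0 (v0 : V) : girth_gt p G -> uniq F ->
  {subset F <= G} -> size F <= p -> (exists2 h, h \in F & h <> h0) ->
  exists2 h, h \in F /\ h <> h0 & forall u w, u \in h -> w \in h ->
    (exists h', [/\ h' \in F, h' <> h & u \in h']) ->
    (exists h', [/\ h' \in F, h' <> h & w \in h']) -> u = w.
Proof.
move=> gG uF sF szF [h1 h1F h1n].
have Fn : F <> [::] by case: (F) h1F.
have [h hF hP] := gG F v0 uF sF Fn szF.
have [hh0|/eqP hn] := eqVneq h h0; last first.
  exists h => // u w uh wh tu tw; apply: hP => //; right; by [].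
subst h0.
have [x xP] : exists x, forall u, u \in h ->
    (exists h', [/\ h' \in F, h' <> h & u \in h']) -> u = x.
  have [[x [xh tx]]|no] := classic (exists x, x \in h /\
      (exists h', [/\ h' \in F, h' <> h & x \in h'])).
    by exists x => u uh tu; apply: hP => //; right.
  by exists v0 => u uh tu; case: no; exists u.
have F1n : rem h F <> [::].
  by move=> E; have := h1F; rewrite (perm_mem (perm_to_rem hF)) E !inE => /eqP.
have sub1 : {subset rem h F <= F} by apply: mem_rem.
have [h2 h2F h2P] := gG (rem h F) x (rem_uniq _ uF) (fun y yF => sF _ (sub1 _ yF)) F1n
  (leq_trans (size_subseq (rem_subseq _ _)) szF).
have h2n : h2 <> h by move=> E; move: h2F; rewrite E mem_rem_uniqF.
exists h2; first by split => //; exact: sub1.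
have aux u : u \in h2 -> (exists h', [/\ h' \in F, h' <> h2 & u \in h']) ->
    touched (rem h F) h2 x u.
  move=> uh [h' [h'F h'n uh']].
  have [E|/eqP h'h] := eqVneq h' h.
    left; apply: xP; first by rewrite -E.
    by exists h2; split => //; exact: sub1.
  by right; exists h'; split => //; rewrite (mem_rem_uniq _ uF) !inE; apply/andP; split => //; exact/eqP.
by move=> u w uh wh tu tw; apply: h2P => //; apply: aux.
Qed.
End Girth.

(** The hypergraphs of Erdos, Hajnal and Lovasz: [m]-uniform, of girth above [p], and without a
    proper colouring by [C]. *)
Definition sparse_nonuniform p := forall (C : finType) (m : nat),
  exists H : seq (seq nat), [/\ girth_gt p H,
    (forall h, h \in H -> uniq h /\ size h = m) &
    forall chi : nat -> C, exists2 h, h \in H & exists c, forall u, u \in h -> chi u = c].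

(* [A] lists the parts on which every colouring [chi] has already been made to depend
   on the part alone, in some copy of each small set of parts. *)
Definition partite p (C : finType) (P : seq nat) k (A : seq nat)
    (G : seq (seq nat)) (pi : nat -> nat) :=
  [/\ girth_gt p G,
    (forall e, e \in G -> uniq (map pi e) /\ size e <= k) &
    forall chi : nat -> C, exists chi0 : nat -> C,
      forall S, uniq S -> {subset S <= P} -> size S <= k ->
      exists2 e, e \in G & map pi e = S /\ forall u, u \in e -> pi u \in A -> chi u = chi0 (pi u)].

Definition sparse_partite p := forall (C : finType) (P : seq nat) k,
  exists G pi, partite p C P k P G pi.

Lemma sparse_partite0 : sparse_partite 0.
Proof.
move=> C P k; exists [seq S <- seqs_upto P k | uniq S], id; split.
- by move=> F v _ _; case: F.
- by move=> e; rewrite mem_filter mem_seqs_upto map_id => /and3P[-> ->].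
- move=> chi; exists chi => S uS sS szS; exists S; last by rewrite map_id.
  rewrite mem_filter mem_seqs_upto uS szS /=; apply/allP => x; exact: sS.
Qed.

(** Each set of parts gets an edge of its own, disjoint from all others, so every girth bound holds;
    with [A] empty the colours are not constrained. *)
Lemma partite_start p C P k : exists G pi, partite p C P k [::] G pi.
Proof.
pose ed (S : seq nat) := [seq pickle (S, a) | a <- S].
pose pi u := if @unpickle (seq nat * nat)%type u is Some x then x.2 else 0.
have piE S : map pi (ed S) = S.
  by rewrite /ed -map_comp map_id_in // => a _; rewrite /= /pi pickleK.
exists (map ed [seq S <- seqs_upto P k | uniq S]), pi; split.
- move=> F v uF sF; case: F uF sF => // e F uF sF _ _; exists e; first exact: mem_head.
  suff aux u : u \in e -> touched (e :: F) e v u -> u = v.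
    by move=> u w ue we tu tw; rewrite (aux u) // (aux w).
  move=> ue [//|[e' [e'F ne ue']]]; case: ne.
  have /mapP[S _ eE] := sF _ (mem_head _ _); have /mapP[S' _ e'E] := sF _ e'F.
  move: ue ue'; rewrite eE e'E => /mapP[a _ ->] /mapP[b _] /(pcan_inj (@pickleK _)) [-> _] //.
- move=> e /mapP[S]; rewrite mem_filter mem_seqs_upto => /and3P[uS sS _] ->.
  by rewrite piE size_map.
- move=> chi; exists chi => S uS sS szS; exists (ed S); last by rewrite piE.
  apply: map_f; rewrite mem_filter mem_seqs_upto uS szS /=; apply/allP => x; exact: sS.
Qed.

(** Pigeonhole: among [#|C| * m] parts, [m] have the same colour under [chi0], and the edge over
    these parts is monochromatic. *)
Lemma sparse_nonuniform_of_partite p : sparse_partite p -> sparse_nonuniform p.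
Proof.
move=> sp C m; have [G [pi [gG eG cG]]] := sp C (iota 0 (#|C| * m)) m.
exists [seq e <- G | size e == m]; split.
- move=> F v uF sF; apply: gG => // e /sF; by rewrite mem_filter => /andP[].
- move=> h; rewrite mem_filter => /andP[/eqP hm /eG [u _]]; split => //.
  exact: map_uniq u.
move=> chi; have [chi0 H0] := cG chi; have C0 : 0 < #|C| by apply/card_gt0P; exists (chi 0).
have [c cm] : exists c, m <= size [seq x <- iota 0 (#|C| * m) | chi0 x == c].
  apply/existsP; rewrite -[X in is_true X]negbK negb_exists; apply/negP => /forallP small.
  have : \sum_(c : C) size [seq x <- iota 0 (#|C| * m) | chi0 x == c] < #|C| * m.
    have m0 : 0 < m by have := small (chi 0); rewrite -ltnNge; apply: leq_ltn_trans.
    apply: (@leq_ltn_trans (\sum_(c : C) m.-1)); last first.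
      by rewrite sum_nat_const ltn_pmul2l // prednK.
    by apply: leq_sum => c _; rewrite -ltnS (prednK m0) ltnNge small.
  rewrite (eq_bigr (fun c => \sum_(x <- iota 0 (#|C| * m)) (chi0 x == c))); last first.
    by move=> c _; rewrite size_filter -sum1_count big_mkcond.
  rewrite exchange_big /= (eq_bigr (fun=> 1)); first by rewrite sum1_size size_iota ltnn.
  by move=> x _; rewrite (bigD1 (chi0 x)) //= eqxx big1 // => c /negPf; rewrite eq_sym => ->.
set S := take m [seq x <- iota 0 (#|C| * m) | chi0 x == c].
have szS : size S = m by rewrite /S size_takel.
have SP x : x \in S -> (x \in iota 0 (#|C| * m)) && (chi0 x == c).
  by move=> /mem_take; rewrite mem_filter andbC.
have [|||e eGe [pe ce]] := H0 S.
- by rewrite take_uniq // filter_uniq // iota_uniq.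
- by move=> x /SP /andP[].
- by rewrite szS.
exists e; first by rewrite mem_filter eGe andbT -(size_map pi) pe szS.
exists c => u ue; have /SP /andP[uP /eqP <-] : pi u \in S by rewrite -pe map_f.
exact: ce.
Qed.

Lemma uniq_map_inj_in (T T' : eqType) (f : T -> T') (s : seq T) :
  uniq (map f s) -> {in s &, injective f}.
Proof.
move=> u x y xs ys E; apply/eqP/negPn/negP => ne.
have := u; rewrite (perm_uniq (perm_map f (perm_to_rem xs))) /= => /andP[/negP ni _].
apply: ni; rewrite E; apply: map_f; rewrite (mem_rem_uniq _ (map_uniq u)) !inE ys andbT.
by rewrite eq_sym.
Qed.

(** * Partite amalgamation *)

Section Amalgam.
Variables (G H : seq (seq nat)) (pi : nat -> nat) (a : nat).
Let V := [seq u <- undup (flatten G) | pi u == a].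
Hypothesis H_ok : forall h, h \in H -> uniq h /\ size h = size V.

(* One copy of [G] for each edge [h] of [H], glued along the part [V] over [a], which
   is identified with [h]. *)
Definition am_copy (h : seq nat) (w : nat) : nat :=
  if pi w == a then @pickle (nat + seq nat * nat)%type (inl (nth 0 h (index w V)))
  else @pickle (nat + seq nat * nat)%type (inr (h, w)).

Definition am_pi (u : nat) : nat :=
  match @unpickle (nat + seq nat * nat)%type u with
  | Some (inr (_, w)) => pi w
  | _ => a
  end.

Definition amalgam := [seq map (am_copy h) e | h <- H, e <- G].

Lemma am_copy_pi h w : am_pi (am_copy h w) = pi w.
Proof. by rewrite /am_pi /am_copy; case: eqP => [<-|_]; rewrite pickleK. Qed.

Lemma am_copyV h w e : h \in H -> e \in G -> w \in e -> pi w = a ->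
  [/\ nth 0 h (index w V) \in h, nth 0 V (index (nth 0 h (index w V)) h) = w &
      am_copy h w = @pickle (nat + seq nat * nat)%type (inl (nth 0 h (index w V)))].
Proof.
move=> /H_ok [uh sh] eG we pw.
have wV : w \in V.
  by rewrite mem_filter pw eqxx mem_undup /=; apply/flattenP; exists e.
have lt : index w V < size h by rewrite sh index_mem.
by rewrite mem_nth // index_uniq // nth_index // /am_copy pw eqxx.
Qed.

Lemma am_copy_inj h w w' e e' : h \in H -> e \in G -> e' \in G -> w \in e -> w' \in e' ->
  am_copy h w = am_copy h w' -> w = w'.
Proof.
move=> hH eG eG' we we' E; have Epi : pi w = pi w' by rewrite -!(am_copy_pi h) E.
have [pw|/eqP pw] := eqVneq (pi w) a.
  have [_ i1 c1] := am_copyV hH eG we pw.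
  have [_ i2 c2] := am_copyV hH eG' we' (etrans (esym Epi) pw).
  rewrite -i1 -i2; move: E; rewrite c1 c2 => /(pcan_inj (@pickleK _)) [->] //.
move: E; rewrite /am_copy -Epi (negPf (introN eqP pw)).
by move=> /(pcan_inj (@pickleK _)) [].
Qed.

Lemma am_copy_cross h h' w w' : h <> h' -> am_copy h w = am_copy h' w' ->
  [/\ pi w = a, pi w' = a & nth 0 h (index w V) = nth 0 h' (index w' V)].
Proof.
move=> hh E; have Epi : pi w = pi w' by rewrite -(am_copy_pi h) E am_copy_pi.
move: E; rewrite /am_copy -Epi; case: eqP => [pw|_] /(pcan_inj (@pickleK _)) [] //.
Qed.

Lemma am_copy_inr h w h' w' :
  am_copy h w = @pickle (nat + seq nat * nat)%type (inr (h', w')) -> h = h' /\ w = w'.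
Proof. by rewrite /am_copy; case: eqP => _ /(pcan_inj (@pickleK _)) // [-> ->]. Qed.

Variable p : nat.
Hypotheses (gG : girth_gt p.+1 G) (gH : girth_gt p H).
Hypothesis pi_inj : forall e, e \in G -> uniq (map pi e).

(** Distinct copies meet only over [a], and an edge has at most one vertex there; so if all edges of
    [F] come from distinct copies, an edge that meets the root at most over [a] is a leaf. Otherwise
    at most [p] copies occur: the girth of [H] gives a copy attached to the others in one vertex,
    and the girth of [G] a leaf inside that copy. Hence [H] needs girth above [p] only, which makes
    the induction on [p] work. *)
Lemma amalgam_girth : girth_gt p.+1 amalgam.
Proof.
move=> F v uF sF Fn szF.
pose good f (he : seq nat * seq nat) :=
  [/\ he.1 \in H, he.2 \in G & f = map (am_copy he.1) he.2].
pose sel f := epsilon (inhabits ([::], [::])) (good f).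
have selP f : f \in F -> good f (sel f).
  move=> /sF /allpairsP[he [h1 h2 h3]]; apply: epsilon_spec; exists he; by split.
pose hf f := (sel f).1; pose ef f := (sel f).2.
have hfP f : f \in F -> [/\ hf f \in H, ef f \in G & f = map (am_copy (hf f)) (ef f)].
  exact: selP.
have fM f u : f \in F -> u \in f -> exists2 z, z \in ef f & u = am_copy (hf f) z.
  by move=> fF; have [_ _ {1}->] := hfP f fF => /mapP.
set Hs := undup (map hf F).
have HsP h : (h \in Hs) -> exists2 f, f \in F & h = hf f.
  by rewrite mem_undup => /mapP.
have Hs_in f : f \in F -> hf f \in Hs by move=> fF; rewrite mem_undup map_f.
have HsH : {subset Hs <= H} by move=> h /HsP [f /hfP [fH _ _] ->].
have uHs : uniq Hs by apply: undup_uniq.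
have szHs : size Hs <= size F by rewrite (leq_trans (size_undup _)) // size_map.
have [szlt|szge] := ltnP (size Hs) (size F); last first.
  have umap : uniq (map hf F).
    by move: szge; rewrite -(size_map hf) leqNgt ltn_size_undup negbK.
  have inj f f' : f \in F -> f' \in F -> hf f = hf f' -> f = f'.
    exact: (uniq_map_inj_in umap).
  have [[f [fF fv]]|all_v] := classic (exists f, f \in F /\
      forall z, z \in ef f -> am_copy (hf f) z = v -> pi z = a).
    exists f => // u w uf wf.
    have [z zf uE] := fM f u fF uf; have [z' zf' wE] := fM f w fF wf.
    have aux x : x \in ef f -> touched F f v (am_copy (hf f) x) -> pi x = a.
      move=> xf [xv|[f' [f'F ne]]]; first exact: fv.
      move=> /(fM _ _ f'F) [x' _ E].
      by have [] := am_copy_cross (fun E' => ne (inj _ _ f'F fF (esym E'))) E.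
    have [fH fG _] := hfP f fF.
    rewrite uE wE => /(aux _ zf) pz /(aux _ zf') pz'; congr am_copy.
    have := pi_inj fG => /(uniq_map_inj_in) /(_ z z' zf zf'); apply; congruence.
  have [f fF] : exists f, f \in F by case: (F) Fn => // f F' _; exists f; exact: mem_head.
  have vF f' : f' \in F -> exists w, v = @pickle (nat + seq nat * nat)%type (inr (hf f', w)).
    move=> f'F; apply: NNPP => no; apply: all_v; exists f'; split => // z zf zv.
    apply: NNPP => pz; apply: no; exists z.
    by rewrite -zv /am_copy (negPf (introN eqP pz)).
  have single f' : f' \in F -> f' = f.
    move=> f'F; have [w E] := vF _ f'F; have [w' E'] := vF _ fF.
    apply: inj => //; move: E; rewrite E' => /(pcan_inj (@pickleK _)) [] //.
  have only_v x : touched F f v x -> x = v.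
    by move=> [//|[f' [f'F ne _]]]; case: ne; exact: single.
  by exists f => // u w _ _ /only_v -> /only_v ->.
have {}szlt : size Hs <= p by rewrite -ltnS (leq_trans szlt).
(* Reduction to the girth of [G]: all contacts of the copy [h] with the root and with other copies
   must happen at the single vertex [w0]. *)
have finish h w0 : h \in Hs ->
    (forall f z, f \in F -> hf f = h -> z \in ef f -> touched F f v (am_copy h z) ->
       touched [seq ef f | f <- F & hf f == h] (ef f) w0 z) ->
    exists2 f, f \in F & forall u w, u \in f -> w \in f ->
      touched F f v u -> touched F f v w -> u = w.
  move=> hHs tch; set E := [seq ef f | f <- F & hf f == h].
  have uE : uniq E.
    rewrite map_inj_in_uniq ?filter_uniq // => f f'.
    rewrite !mem_filter => /andP[/eqP e1 fF] /andP[/eqP e2 f'F] ee.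
    by have [_ _ ->] := hfP f fF; have [_ _ ->] := hfP f' f'F; rewrite e1 e2 ee.
  have sE : {subset E <= G}.
    by move=> e /mapP[f]; rewrite mem_filter => /andP[_ /hfP[_ ? _]] ->.
  have En : E <> [::].
    have [f fF hE] := HsP _ hHs => E0.
    have : ef f \in E by apply: map_f; rewrite mem_filter hE eqxx.
    by rewrite E0.
  have szE : size E <= p.+1.
    by rewrite size_map size_filter (leq_trans (count_size _ _)).
  have [e /mapP[f]] := gG w0 uE sE En szE.
  rewrite mem_filter => /andP[/eqP fh fF] -> fP; exists f => // u w uf wf.
  have [z zf ->] := fM f u fF uf; have [z' zf' ->] := fM f w fF wf.
  rewrite fh => tz tz'; congr am_copy; apply: fP => //; exact: tch.
(* [Sp] marks the vertices of [h] at which another copy or the root can touch it. *)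
have finish_sp h (Sp : nat -> Prop) : h \in Hs ->
    (forall y y', y \in h -> y' \in h -> Sp y -> Sp y' -> y = y') ->
    (forall y h', y \in h -> h' \in Hs -> h' <> h -> y \in h' -> Sp y) ->
    (forall f z, f \in F -> hf f = h -> z \in ef f -> am_copy h z = v ->
      pi z = a /\ Sp (nth 0 h (index z V))) ->
    exists2 f, f \in F & forall u w, u \in f -> w \in f ->
      touched F f v u -> touched F f v w -> u = w.
  move=> hHs Sp1 Sp2 Sp3.
  have [w0 w0P] : exists w0, forall y, y \in h -> Sp y -> nth 0 V (index y h) = w0.
    have [[y [yh sy]]|no] := classic (exists y, y \in h /\ Sp y).
      by exists (nth 0 V (index y h)) => y' yh' sy'; rewrite (Sp1 y y').
    by exists 0 => y yh sy; case: no; exists y.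
  apply: (finish h w0 hHs) => f z fF fh zf [zv|[f' [f'F ne]]].
    left; have [fH fG _] := hfP f fF.
    have [pz sz] := Sp3 f z fF fh zf zv.
    have [n1 n2 _] := am_copyV (HsH _ hHs) fG zf pz.
    by rewrite -(w0P _ n1 sz).
  have [fH fG fE] := hfP f fF; have [fH' fG' fE'] := hfP f' f'F.
  move=> /(fM _ _ f'F) [z' zf' E].
  have [hh|/eqP hh] := eqVneq (hf f') h.
    have zz : z = z'.
      by rewrite hh in E; apply: (am_copy_inj _ fG fG' zf zf' E); exact: HsH.
    right; exists (ef f'); split => //; last by rewrite zz.
    - by apply: map_f; rewrite mem_filter hh eqxx.
    - by move=> ee; apply: ne; rewrite fE fE' ee fh hh.
  left; have [pz pz' Enth] := am_copy_cross (fun X => hh (esym X)) E.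
  have [n1 n2 _] := am_copyV (HsH _ hHs) fG zf pz.
  have [n1' _ _] := am_copyV fH' fG' zf' pz'.
  rewrite -(w0P _ n1) //; apply: (Sp2 _ (hf f')) => //; first exact: Hs_in.
  by rewrite Enth.
have Hsn : Hs <> [::].
  case: (F) Fn (Hs_in) => // f F' _ X E.
  by have := X f (mem_head _ _); rewrite E.
(* A root outside the part [a] is private to one copy [h0], so the leaf copy must differ from [h0]
   unless [h0] is the only copy. *)
have [[h0 [w1 [vE h0Hs]]]|nov] := classic (exists h0 w1,
    v = @pickle (nat + seq nat * nat)%type (inr (h0, w1)) /\ h0 \in Hs).
  have [[h1 h1Hs ne1]|single] := classic (exists2 h, h \in Hs & h <> h0).
    have [h [hHs hn] hP] := girth_gt_rooted 0 gH uHs HsH szlt (ex_intro2 _ _ h1 h1Hs ne1).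
    apply: (finish_sp h (fun y => exists h', [/\ h' \in Hs, h' <> h & y \in h'])) => //.
    - by move=> y h' yh h'Hs ne yh'; exists h'.
    - by move=> f z fF fh zf; rewrite vE => /am_copy_inr [].
  have single' h : h \in Hs -> h = h0.
    by move=> hHs; apply: NNPP => ne; apply: single; exists h.
  apply: (finish h0 w1) => // f z fF fh zf [zv|[f' [f'F ne]]].
    by left; move: zv; rewrite vE => /am_copy_inr [].
  have [fH fG fE] := hfP f fF; have [fH' fG' fE'] := hfP f' f'F.
  have fh' : hf f' = h0 by apply: single'; exact: Hs_in.
  move=> /(fM _ _ f'F) [z' zf']; rewrite fh' => E.
  right; exists (ef f'); split.
  - by apply: map_f; rewrite mem_filter fh' eqxx.
  - by move=> ee; apply: ne; rewrite fE fE' ee fh fh'.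
  - by rewrite (am_copy_inj (HsH _ h0Hs) fG fG' zf zf' E).
pose y0 := if @unpickle (nat + seq nat * nat)%type v is Some (inl y) then y else 0.
have [h hHs hP] := gH y0 uHs HsH Hsn szlt.
apply: (finish_sp h (touched Hs h y0)) => //.
- by move=> y h' yh h'Hs ne yh'; right; exists h'.
- move=> f z fF fh zf zv; have pz : pi z = a.
    apply: NNPP => pz; apply: nov; exists h, z; split => //.
    by rewrite -zv /am_copy (negPf (introN eqP pz)).
  split => //; left; rewrite /y0 -zv.
  have [fH fG _] := hfP f fF.
  by have [_ _ ->] := am_copyV (HsH _ hHs) fG zf pz; rewrite pickleK.
Qed.
End Amalgam.

(** A monochromatic edge of [H] singles out a copy of [G] whose part over [a] has one colour; the
    property of [G] inside this copy handles the parts in [A]. *)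
Lemma partite_add p (C : finType) P k A a G pi : sparse_nonuniform p ->
  partite p.+1 C P k A G pi -> exists G' pi', partite p.+1 C P k (a :: A) G' pi'.
Proof.
move=> sn [gG eG cG].
have [H [gH H_ok cH]] := sn C (size [seq u <- undup (flatten G) | pi u == a]).
exists (amalgam G H pi a), (am_pi pi a).
have map_pi h e : map (am_pi pi a) (map (am_copy G pi a h) e) = map pi e.
  by rewrite -map_comp; apply: eq_map => w /=; exact: am_copy_pi.
split.
- by apply: amalgam_girth => // e /eG [].
- by move=> f /allpairsP[[h e] /= [hH eGe ->]]; rewrite map_pi size_map; exact: eG.
move=> chi.
have [h hH [c hc]] := cH (fun y => chi (@pickle (nat + seq nat * nat)%type (inl y))).
have [chi0 H0] := cG (fun w => chi (am_copy G pi a h w)).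
exists (fun x => if x == a then c else chi0 x) => S uS sS szS.
have [e eGe [eS ce]] := H0 S uS sS szS.
exists (map (am_copy G pi a h) e).
  by apply/allpairsP; exists (h, e).
rewrite map_pi; split => // u /mapP[w we ->]; rewrite am_copy_pi inE.
case: eqP => [pw _|_ /=]; last exact: ce.
have [yh _ ->] := am_copyV H_ok hH eGe we pw; exact: hc.
Qed.

Theorem sparse_partite_all p : sparse_partite p.
Proof.
elim: p => [|p /sparse_nonuniform_of_partite sn]; first exact: sparse_partite0.
move=> C P k.
suff X A : exists G pi, partite p.+1 C P k A G pi by exact: X.
elim: A => [|a A [G [pi]]]; first exact: partite_start.
exact: partite_add.
Qed.

(** * Sparse lifts of instances *)

Lemma In_flatten (T : Type) (T' : eqType) (f : T -> seq T') (s : seq T) x y :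
  List.In x s -> y \in f x -> y \in flatten (map f s).
Proof.
elim: s => //= z s IH [->|/IH X] yx; rewrite mem_cat ?yx // => *.
by rewrite X ?orbT.
Qed.

Lemma flatten_In (T : Type) (T' : eqType) (f : T -> seq T') (s : seq T) y :
  y \in flatten (map f s) -> exists2 x, List.In x s & y \in f x.
Proof.
elim: s => //= z s IH; rewrite mem_cat => /orP[yz|/IH [x xs yx]].
  by exists z => //; left.
by exists x => //; right.
Qed.

Lemma InP (T : eqType) (x : T) s : reflect (List.In x s) (x \in s).
Proof.
elim: s => [|y s IH] /=; first by constructor.
rewrite inE; apply: (iffP orP) => [[/eqP ->|/IH]|[->|/IH]]; auto.
Qed.

Section Lift.
Variables (E : finType) (ar : E -> nat).
Implicit Types (I J : instance E) (Pi : program E).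

Definition hom (h : nat -> nat) I J := forall f, f \in I -> (f.1, map h f.2) \in J.

Lemma mem_adom I f x : f \in I -> x \in f.2 -> x \in adom I.
Proof. by move=> fI xf; apply/flattenP; exists f.2 => //; exact: map_f. Qed.

Lemma adomP I x : reflect (exists2 f, f \in I & x \in f.2) (x \in adom I).
Proof.
apply: (iffP flattenP) => [[_ /mapP[f fI ->] xf]|[f fI xf]]; first by exists f.
by exists f.2 => //; exact: map_f.
Qed.

Lemma entails_hom h I J Pi : hom h I J -> prog_entails I Pi -> prog_entails J Pi.
Proof.
move=> hh HI U N G mod; apply: (HI (fun p a => U p (h a)) N G) => r /mod sat s bs.
have [|hd [hdr hds]] := sat (h \o s).
  move=> a /bs; case: a => //= R xs /hh /=; by rewrite -map_comp.
by exists hd; split => //; case: hd hdr hds.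
Qed.

Lemma rule_vars_body Pi r x : wf_mddlog ar Pi -> List.In r Pi ->
  (x \in rule_vars r) = (x \in body_vars r).
Proof.
move=> wf /wf [_ [_ [hb _]]]; rewrite mem_undup mem_cat orbC.
case: (boolP (x \in body_vars r)) => //= /negP nb; apply/negbTE/negP => /flatten_In [h].
by case: h => //= p y /hb yb; rewrite inE => /eqP E0; apply: nb; rewrite E0.
Qed.

Lemma size_rule_vars Pi r : List.In r Pi -> size (rule_vars r) <= diameter Pi.
Proof.
rewrite /diameter; elim: Pi => //= r' Pi IH; rewrite big_cons => -[->|/IH le].
  exact: leq_maxl.
exact: leq_trans (leq_maxr _ _).
Qed.

Definition hname (h : hatom) :=
  match h with HU p _ => [:: p] | HN p => [:: p] | HGoal => [::] end.
Definition bname (b : batom E) :=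
  match b with BU p _ => [:: p] | BN p => [:: p] | BE _ _ => [::] end.
Definition idb_names Pi :=
  flatten [seq flatten (map hname (Defs.head r)) ++ flatten (map bname (body r)) | r <- Pi].

Lemma idb_names_head Pi r h p : List.In r Pi -> List.In h (Defs.head r) ->
  p \in hname h -> p \in idb_names Pi.
Proof.
move=> rP hr ph; apply: (In_flatten rP); rewrite mem_cat; apply/orP; left.
exact: In_flatten ph.
Qed.

Lemma idb_names_body Pi r a p : List.In r Pi -> List.In a (body r) ->
  p \in bname a -> p \in idb_names Pi.
Proof.
move=> rP hr pa; apply: (In_flatten rP); rewrite mem_cat; apply/orP; right.
exact: In_flatten pa.
Qed.

(** The parts are the elements of [I], the colours the sets of IDB names of [Pi]. For a model on
    [I'], the induced colouring [chi0] is a model on [I]: the image of a rule match is a set of at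
    most [k] parts, hence has an edge above it on which the two colourings agree, and the match
    moves there. *)
Theorem sparse_lift Pi p k I : wf_mddlog ar Pi -> diameter Pi <= k -> inst_wf ar I ->
  exists I' G pi, [/\ girth_gt p G, forall e, e \in G -> uniq e /\ size e <= k,
    forall f, f \in I' -> exists2 e, e \in G & {subset f.2 <= e},
    inst_wf ar I' & hom pi I' I /\ (prog_entails I Pi -> prog_entails I' Pi)].
Proof.
move=> wf dk wfI; set ns := idb_names Pi.
have [G [pi [gG eG cG]]] := sparse_partite_all p {ffun 'I_(size ns) -> bool} (adom I) k.
pose lift e x := nth 0 e (index x (map pi e)).
pose I' := [seq (f.1, map (lift e) f.2) | e <- G, f <- [seq f <- I | all [in map pi e] f.2]].
have liftK e x : x \in map pi e -> pi (lift e x) = x.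
  by move=> xe; rewrite -(nth_map _ 0) ?nth_index // -(size_map pi) index_mem.
have lift_in e x : x \in map pi e -> lift e x \in e.
  by move=> xe; rewrite mem_nth // -(size_map pi) index_mem.
have I'P f : f \in I' -> exists e g, [/\ e \in G, g \in I, all [in map pi e] g.2 &
    f = (g.1, map (lift e) g.2)].
  move=> /allpairsPdep[e [g [eGe]]]; rewrite mem_filter => /andP[ge gI] ->.
  by exists e, g.
have I'I e R xs : e \in G -> (R, xs) \in I -> all [in map pi e] xs ->
    (R, map (lift e) xs) \in I'.
  move=> eGe fI fe; apply/allpairsPdep; exists e, (R, xs); split => //.
  by rewrite mem_filter fe.
exists I', G, pi; split => //.
- by move=> e /eG [/map_uniq].
- move=> f /I'P[e [g [eGe gI ge ->]]]; exists e => // _ /mapP[x xg ->].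
  by apply: lift_in; exact: (allP ge).
- by move=> f /I'P[e [g [eGe gI ge ->]]] /=; rewrite size_map; exact: wfI.
split.
  move=> f /I'P[e [g [eGe gI ge ->]]] /=; rewrite -map_comp map_id_in; first by case: (g) gI.
  by move=> x xg /=; apply: liftK; exact: (allP ge).
move=> HI U N Q mod.
pose chi u : {ffun 'I_(size ns) -> bool} := [ffun i => decide (U (nth 0 ns (nat_of_ord i)) u)].
have [chi0 H0] := cG chi.
(* Confining [U0] to [adom I] sends even a variable that occurs in unary atoms only to one of the
   parts. *)
pose U0 q x := x \in adom I /\ exists2 i : 'I_(size ns), nth 0 ns (nat_of_ord i) = q & chi0 x i.
have U0P q u : q \in ns -> pi u \in adom I -> chi u = chi0 (pi u) -> U0 q (pi u) <-> U q u.
  move=> qn ua cu; split.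
    by move=> [_ [i <-]]; rewrite -cu ffunE => /decideP.
  move=> Uq; split => //; have lt : index q ns < size ns by rewrite index_mem.
  exists (Ordinal lt); first by rewrite /= nth_index.
  by rewrite -cu ffunE /= nth_index //; apply/decideP.
apply: (HI U0 N Q) => r rP s bs.
have varsI x : x \in rule_vars r -> s x \in adom I.
  rewrite (rule_vars_body _ wf rP) => /flatten_In [[R xs|q y|q]] //=.
    by move=> /bs /= fI xx; apply: (mem_adom fI); exact: map_f.
  by move=> /bs /= [ya _]; rewrite inE => /eqP ->.
have [|||e eGe [eS ce]] := H0 (undup (map s (rule_vars r))).
- exact: undup_uniq.
- by move=> x; rewrite mem_undup => /mapP[y /varsI ya ->].
- rewrite (leq_trans (size_undup _)) // size_map (leq_trans _ dk) //.
  exact: size_rule_vars.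
have se x : x \in rule_vars r -> s x \in map pi e.
  by move=> xr; rewrite eS mem_undup map_f.
pose s' x := lift e (s x).
have s'K x : x \in rule_vars r -> pi (s' x) = s x by move=> /se; exact: liftK.
have s'c x : x \in rule_vars r -> chi (s' x) = chi0 (pi (s' x)).
  by move=> xr; apply: ce; [apply: lift_in; exact: se|rewrite s'K // varsI].
have Us q x : q \in ns -> x \in rule_vars r -> U0 q (s x) <-> U q (s' x).
  by move=> qn xr; rewrite -{1}(s'K x xr); apply: U0P => //; [rewrite s'K // varsI|exact: s'c].
have bv a x : List.In a (body r) -> x \in batom_vars a -> x \in rule_vars r.
  by move=> ar' xa; rewrite (rule_vars_body _ wf rP); apply: (In_flatten ar').
have [|hd [hdr hds]] := mod r rP s'.
  move=> a ar'; have := bs a ar'; case: a ar' => //= [R xs|q x] ar'.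
    move=> fI; have := I'I e _ _ eGe fI; rewrite -map_comp; apply.
    by apply/allP => _ /mapP[x xx ->]; apply: se; exact: (bv _ _ ar').
  move=> /Us; apply; first by apply: (idb_names_body rP ar'); rewrite inE.
  by apply: (bv _ _ ar'); rewrite inE.
exists hd; split => //; case: hd hdr hds => //= q x hdr.
move=> /Us; apply; first by apply: (idb_names_head rP hdr); rewrite inE.
by rewrite mem_undup mem_cat; apply/orP; left; apply: (In_flatten hdr); rewrite inE.
Qed.
End Lift.

(** * Monadic Datalog rewritings *)

Section BatomCountable.
Variable E : finType.

Definition code_batom (a : batom E) : E * seq nat + (nat * nat + nat) :=
  match a with BE R xs => inl (R, xs) | BU p x => inr (inl (p, x)) | BN p => inr (inr p) end.
Definition decode_batom (c : E * seq nat + (nat * nat + nat)) : batom E :=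
  match c with
  | inl (R, xs) => BE R xs | inr (inl (p, x)) => BU E p x | inr (inr p) => BN E p
  end.
Lemma code_batomK : cancel code_batom decode_batom. Proof. by case. Qed.
HB.instance Definition _ := Countable.copy (batom E) (can_type code_batomK).
End BatomCountable.

Section Rename.
Variable E : finType.
Implicit Types (I : instance E) (a : batom E).

Definition brename (f : nat -> nat) a : batom E :=
  match a with BE R xs => BE R (map f xs) | BU p x => BU E p (f x) | BN p => BN E p end.

Lemma brename_vars f a : batom_vars (brename f a) = map f (batom_vars a).
Proof. by case: a. Qed.

Lemma brename_holds I U N s f a :
  batom_holds I U N s (brename f a) <-> batom_holds I U N (s \o f) a.
Proof. by case: a => //= R xs; rewrite -map_comp. Qed.

Lemma eq_batom_holds I U N s t a : {in batom_vars a, s =1 t} ->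
  batom_holds I U N s a -> batom_holds I U N t a.
Proof.
case: a => //= [R xs|p x] st; first by have -> : map s xs = map t xs by apply/eq_in_map.
by rewrite st // inE.
Qed.

Definition bvars (C : seq (batom E)) := flatten (map (@batom_vars E) C).

Lemma mem_bvars C a x : a \in C -> x \in batom_vars a -> x \in bvars C.
Proof. by move=> aC xa; apply/flattenP; exists (batom_vars a) => //; exact: map_f. Qed.

Lemma bvarsP C x : reflect (exists2 a, a \in C & x \in batom_vars a) (x \in bvars C).
Proof.
apply: (iffP flattenP) => [[_ /mapP[a aC ->] xa]|[a aC xa]]; first by exists a.
by exists (batom_vars a) => //; exact: map_f.
Qed.
End Rename.

Section Datalog.
Variables (E : finType) (ar : E -> nat) (P : program E).
Implicit Types (I : instance E) (a : batom E).

Definition leastU I p x := forall U N G, (forall r, List.In r P -> rule_sat I U N G r) -> U p x.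
Definition leastN I p := forall U N G, (forall r, List.In r P -> rule_sat I U N G r) -> N p.

(** With one atom per head, the intersection of all models is again a model; a disjunctive head
    could be satisfied by different disjuncts in different models. *)
Lemma least_model I r : (forall r', List.In r' P -> size (Defs.head r') = 1) -> List.In r P ->
  rule_sat I (leastU I) (leastN I) (prog_entails I P) r.
Proof.
move=> sz rP s bs; move: (sz r rP); case Er : (Defs.head r) => [|h [|]] // _.
exists h; split; first by left.
have X U N G : (forall r', List.In r' P -> rule_sat I U N G r') -> hatom_holds U N G s h.
  move=> mod; have [|h' []] := mod r rP s.
    by move=> a /bs; case: a => [R xs|p x|p] //= H; exact: (H U N G mod).
  by rewrite Er /= => -[<-|//].
by case: h X {Er} => [p x|p|] X U N G mod; exact: (X U N G mod).
Qed.

(* Names of the new program: even for the IDB relations of [P], odd for the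
   conjunctive queries over such names, so that queries may be nested. *)
Definition cq_name (b : seq (batom E)) : nat := (pickle b).*2.+1.

(** The intended meaning of the names; a query used as a unary relation has [0] as its answer
    variable. The three kinds of atoms are separate premises so that all occurrences stay strictly
    positive. *)
Inductive semU I : nat -> nat -> Prop :=
  | semU_base p x : leastU I p x -> semU I p.*2 x
  | semU_cq b s : (forall R xs, BE R xs \in b -> (R, map s xs) \in I) ->
      (forall p x, BU E p x \in b -> semU I p (s x)) ->
      (forall p, BN E p \in b -> semN I p) -> semU I (cq_name b) (s 0)
with semN I : nat -> Prop :=
  | semN_base p : leastN I p -> semN I p.*2
  | semN_cq b s : (forall R xs, BE R xs \in b -> (R, map s xs) \in I) ->
      (forall p x, BU E p x \in b -> semU I p (s x)) ->
      (forall p, BN E p \in b -> semN I p) -> semN I (cq_name b).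

Definition sem I s a := batom_holds I (semU I) (semN I) s a.

Lemma cq_name_inj b b' : cq_name b = cq_name b' -> b = b'.
Proof. by move=> /eq_add_S /double_inj /(pcan_inj (@pickleK _)). Qed.

Lemma cq_name_base b p : cq_name b <> p.*2.
Proof. by move=> /(congr1 odd) /=; rewrite !odd_double. Qed.

Lemma semU_baseE I p x : semU I p.*2 x -> leastU I p x.
Proof.
move Eq : p.*2 => q H; case: H Eq => [p' y H /double_inj -> //|b s _ _ _ /esym /cq_name_base //].
Qed.

Lemma semN_baseE I p : semN I p.*2 -> leastN I p.
Proof.
move Eq : p.*2 => q H; case: H Eq => [p' H /double_inj -> //|b s _ _ _ /esym /cq_name_base //].
Qed.

Lemma semU_cqP I b x :
  semU I (cq_name b) x <-> exists2 s, s 0 = x & forall a, a \in b -> sem I s a.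
Proof.
split=> [|[s <- H]].
  move Eq : (cq_name b) => q H; case: H Eq => [p' y _ /cq_name_base //|b' s h1 h2 h3 /cq_name_inj ->].
  by exists s => // -[R xs|p y|p] /=; [exact: h1|exact: h2|exact: h3].
by apply: semU_cq => [R xs|p y|p] /H.
Qed.

Lemma semN_cqP I b :
  semN I (cq_name b) <-> exists s, forall a, a \in b -> sem I s a.
Proof.
split=> [|[s H]].
  move Eq : (cq_name b) => q H; case: H Eq => [p' _ /cq_name_base //|b' s h1 h2 h3 /cq_name_inj ->].
  by exists s => -[R xs|p y|p] /=; [exact: h1|exact: h2|exact: h3].
by apply: (semN_cq (s := s)) => [R xs|p y|p] /H.
Qed.

Variables (k b : nat).

Definition edb_atoms : seq (batom E) :=
  flatten [seq [seq BE R xs | xs <- seqs_upto (iota 0 k) (ar R) & size xs == ar R] | R <- enum E].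

Definition atoms (ns : seq nat) : seq (batom E) :=
  edb_atoms ++ [seq BU E n x | n <- ns, x <- iota 0 k] ++ map (BN E) ns.

Definition named (ns : seq nat) a : Prop :=
  match a with BE R xs => size xs = ar R | BU n _ => n \in ns | BN n => n \in ns end.

Lemma atomsP ns a :
  a \in atoms ns <-> named ns a /\ forall x, x \in batom_vars a -> x < k.
Proof.
rewrite !mem_cat; split.
  case/or3P=> [/flatten_mapP[R _ /mapP[xs]]|/allpairsP[[n x] /= [nns]]|/mapP[n nns ->]] //.
    rewrite mem_filter mem_seqs_upto => /and3P[/eqP sz _ al] -> /=; split=> // x /(allP al) /=.
    by rewrite mem_iota.
  by rewrite mem_iota => xk -> /=; split=> // y; rewrite inE => /eqP ->.
case: a => [R xs|n x|n] [/= nm lt].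
- apply/orP; left; apply/flatten_mapP; exists R; first by rewrite mem_enum.
  apply: map_f; rewrite mem_filter mem_seqs_upto nm eqxx leqnn /=.
  by apply/allP => x /lt; rewrite mem_iota.
- apply/or3P/Or32/allpairsP; exists (n, x); split=> //=; rewrite mem_iota /=.
  by apply: lt; rewrite inE.
- by apply/or3P/Or33/map_f.
Qed.

(** Level [m] allows queries nested [m] deep; each removal of an edge raises the level by one. *)
Fixpoint names m : seq nat :=
  if m is m'.+1 then names m' ++ map cq_name (seqs_upto (atoms (names m')) b)
  else map double (idb_names P).

Lemma names_mono m m' : m <= m' -> {subset names m <= names m'}.
Proof.
move=> /subnK <-; elim: (m' - m) => //= d IH n /IH nn; by rewrite mem_cat nn.
Qed.

Lemma named_mono m m' a : m <= m' -> named (names m) a -> named (names m') a.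
Proof. by move=> mm; case: a => //= [n _|n]; exact: names_mono. Qed.

Lemma cq_name_names m c : size c <= b -> (forall a, a \in c -> a \in atoms (names m)) ->
  cq_name c \in names m.+1.
Proof.
move=> sz al; rewrite /= mem_cat; apply/orP; right; apply: map_f.
by rewrite mem_seqs_upto sz; apply/allP.
Qed.

Definition sound (r : rule E) :=
  forall I, rule_sat I (semU I) (semN I) (prog_entails I P) r.

Definition admissible (r : rule E) :=
  [/\ body r <> [::], forall p x, List.In (HU p x) (Defs.head r) -> x \in body_vars r & sound r].

Definition heads (ns : seq nat) : seq hatom := HGoal :: map (fun n => HU n 0) ns ++ map HN ns.

(** All rules of the permitted shape that are true under the intended reading are taken, so
    soundness is immediate and completeness only has to exhibit the rules that it fires. *)
Definition sound_rules : program E :=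
  List.filter (fun r => decide (admissible r))
    (List.map (fun x => Rule [:: x.1] x.2)
       (List.list_prod (heads (names b.+1)) (seqs_upto (atoms (names b)) b))).

(* They only serve to make every name used in a body occur in a head. *)
Definition tautologies : program E :=
  map (fun n => Rule [:: HN n] [:: BN E n]) (names b) ++
  (if k is 0 then [::] else map (fun n => Rule [:: HU n 0] [:: BU E n 0]) (names b)).

Definition narrow : program E := sound_rules ++ tautologies.

Lemma In_cat T (x : T) s t : List.In x (s ++ t) <-> List.In x s \/ List.In x t.
Proof. exact: List.in_app_iff. Qed.

Lemma In_map T T' (f : T -> T') y s : List.In y (map f s) <-> exists x, f x = y /\ List.In x s.
Proof. exact: List.in_map_iff. Qed.

Lemma sound_rulesP r : List.In r sound_rules <->
  exists h c, [/\ r = Rule [:: h] c, List.In h (heads (names b.+1)),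
    size c <= b, (forall a, a \in c -> a \in atoms (names b)) & admissible r].
Proof.
rewrite /sound_rules List.filter_In List.in_map_iff; split.
  move=> [[[h c] [<- /List.in_prod_iff [hh cc]]] /decideP adm].
  move/InP: cc; rewrite mem_seqs_upto => /andP[sz /allP al]; by exists h, c.
move=> [h [c [-> hh sz al adm]]]; split; last exact/decideP.
exists (h, c); split=> //; apply/List.in_prod_iff; split=> //.
by apply/InP; rewrite mem_seqs_upto sz; apply/allP.
Qed.

Lemma tautologiesP r : List.In r tautologies -> 
  exists2 n, n \in names b & r = Rule [:: HN n] [:: BN E n] \/
     0 < k /\ r = Rule [:: HU n 0] [:: BU E n 0].
Proof.
rewrite /tautologies In_cat => -[/In_map[n [<- /InP nn]]|]; first by exists n => //; left.
by case: (k) => //= k' /In_map[n [<- /InP nn]]; exists n => //; right.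
Qed.

Lemma narrow_sound I : prog_entails I narrow -> prog_entails I P.
Proof.
apply=> r; rewrite In_cat => -[/sound_rulesP[h [c [_ _ _ _ [_ _ so]]]]|]; first exact: so.
move=> /tautologiesP[n _ [->|[_ ->]]] s bs; eexists; (split; first by left).
  exact: (bs (BN E n) (or_introl erefl)).
exact: (bs (BU E n 0) (or_introl erefl)).
Qed.

Lemma narrow_wf : wf_mdlog ar narrow.
Proof.
split; last first.
  move=> r; rewrite In_cat => -[/sound_rulesP[h [c [-> //]]]|].
  by move=> /tautologiesP[n _ [->|[_ ->]]].
have tN n : n \in names b -> exists r', List.In r' narrow /\ List.In (HN n) (Defs.head r').
  move=> nn; exists (Rule [:: HN n] [:: BN E n]); split; last by left.
  rewrite In_cat; right; rewrite In_cat; left; apply/In_map; exists n; split=> //; exact/InP.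
have tU n : 0 < k -> n \in names b ->
    exists r' y, List.In r' narrow /\ List.In (HU n y) (Defs.head r').
  move=> k0 nn; exists (Rule [:: HU n 0] [:: BU E n 0]), 0; split; last by left.
  rewrite In_cat; right; rewrite In_cat; right; case: (k) k0 => // k' _.
  apply/In_map; exists n; split=> //; exact/InP.
move=> r; rewrite In_cat => -[/sound_rulesP[h [c [-> hh _ al [/= b0 hv _]]]]|].
  split=> //; split; first by move=> R xs /InP /al /atomsP [].
  split=> //; split; first by move=> [->|[]].
  split=> [p x|p] /InP /al /atomsP [/= pn lt]; last exact: tN.
  by apply: tU => //; apply: leq_ltn_trans (lt x _); rewrite ?inE.
move=> /tautologiesP[n nn [->|[k0 ->]]] /=.
  split=> //; split; first by move=> R xs [].
  split; first by move=> p x [].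
  split; first by move=> [].
  by split=> [p x []//|p [[<-]|//]]; exact: tN.
split=> //; split; first by move=> R xs [].
split; first by move=> p x [[_ <-]|//]; rewrite inE.
split; first by move=> [].
by split=> [p x [[<- _]|//]|p []//]; exact: tU.
Qed.

Lemma narrow_diameter : diameter narrow <= k.
Proof.
rewrite /diameter; suff: forall r, List.In r narrow -> size (rule_vars r) <= k.
  elim: narrow => [|r N IH] H; rewrite ?big_nil ?big_cons // geq_max H /=; last by left.
  by apply: IH => r' rN; apply: H; right.
move=> r; rewrite In_cat => -[/sound_rulesP[h [c [-> hh _ al [/= b0 hv _]]]]|].
  rewrite -(size_iota 0 k); apply: uniq_leq_size; first exact: undup_uniq.
  have bl x : x \in body_vars (Rule [:: h] c) -> x \in iota 0 k.
    by move=> /flatten_In[a /InP /al /atomsP[_ lt] /lt]; rewrite mem_iota.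
  move=> x; rewrite mem_undup mem_cat => /orP[|]; last exact: bl.
  move=> /flatten_In[[p y|p|] //= [//E0|//]]; rewrite inE => /eqP ->; apply: bl; apply: hv.
  by left; exact: E0.
by move=> /tautologiesP[n nn [->|[k0 ->]]].
Qed.
End Datalog.

(** * Completeness of the narrow program on instances of large girth *)

Section Completeness.
Variables (E : finType) (ar : E -> nat) (P : program E) (k b : nat).
Hypothesis P_wf : wf_mdlog ar P.
Hypothesis b_ge : forall r, List.In r P -> size (body r) <= b.
Variables (I : instance E) (G : seq (seq nat)).
Hypothesis gG : girth_gt b G.
Hypothesis G_ok : forall e, e \in G -> uniq e /\ size e <= k.
Hypothesis G_cover : forall f, f \in I -> exists2 e, e \in G & {subset f.2 <= e}.
Variables (U : nat -> nat -> Prop) (N : nat -> Prop) (Q : Prop).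
Hypothesis mod : forall r, List.In r (narrow ar P k b) -> rule_sat I U N Q r.

Notation holds := (batom_holds I U N id).
Notation names := (names ar P k b).

Lemma narrow_rule_holds h c (s : nat -> nat) : List.In h (heads (names b.+1)) -> size c <= b ->
  c <> [::] -> (forall a, a \in c -> a \in atoms ar k (names b)) ->
  (forall p x, h = HU p x -> x \in bvars c) -> sound P (Rule [:: h] c) ->
  (forall a, a \in c -> batom_holds I U N s a) -> hatom_holds U N Q s h.
Proof.
move=> hh sz c0 al hv so cs.
have rN : List.In (Rule [:: h] c) (narrow ar P k b).
  rewrite /narrow In_cat; left; apply/sound_rulesP; exists h, c; split=> //; split=> //.
  by move=> p x /= [|//]; exact: hv.
have [|h' [/= [<-|//]]] // := mod rN (s := s).
by move=> a /InP /cs.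
Qed.

Lemma cq_sound_U c : sound P (Rule [:: HU (cq_name c) 0] c).
Proof.
move=> J s bs; exists (HU (cq_name c) 0); split; first by left.
by apply/semU_cqP; exists s => // a /InP /bs.
Qed.

Lemma cq_sound_N c : sound P (Rule [:: HN (cq_name c)] c).
Proof.
move=> J s bs; exists (HN (cq_name c)); split; first by left.
by apply/semN_cqP; exists s => a /InP /bs.
Qed.

Lemma names_heads m n : m <= b.+1 -> n \in names m ->
  List.In (HU n 0) (heads (names b.+1)) /\ List.In (HN n) (heads (names b.+1)).
Proof.
move=> /names_mono H /H nn; split; right; apply/In_cat.
  by left; apply/In_map; exists n; split=> //; apply/InP.
by right; apply/In_map; exists n; split=> //; apply/InP.
Qed.

Lemma brename_atoms f m c : {in bvars c, forall u, f u < k} ->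
  (forall a, a \in c -> named ar (names m) a) ->
  forall a, a \in map (brename f) c -> a \in atoms ar k (names m).
Proof.
move=> fk nm _ /mapP[a ac ->]; apply/atomsP; split.
  by move: (nm a ac); case: a {ac} => //= R xs; rewrite size_map.
move=> x; rewrite brename_vars => /mapP[y ya ->]; apply: fk; exact: mem_bvars ya.
Qed.

(* One elimination step: the atoms inside an edge [e] meeting the rest in at most
   one vertex are replaced by a single atom naming their conjunction. *)
Lemma absorb m e c (sp : nat -> Prop) : m < b -> e \in G -> c <> [::] -> size c <= b ->
  (forall a, a \in c -> [/\ named ar (names m) a, holds a & {subset batom_vars a <= e}]) ->
  (forall u v, u \in e -> v \in e -> sp u -> sp v -> u = v) ->
  exists a, [/\ named ar (names m.+1) a, holds a,
    {subset batom_vars a <= bvars c},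
    forall u, u \in batom_vars a -> sp u &
    (forall u, u \in bvars c -> sp u -> u \in batom_vars a) /\
    forall J s, sem P J s a -> exists t,
      (forall u, u \in bvars c -> sp u -> t u = s u) /\ forall a', a' \in c -> sem P J t a'].
Proof.
move=> mb eG c0 sz ca sp1; have [ue se] := G_ok eG.
have ce u : u \in bvars c -> u \in e.
  by move=> /bvarsP[a ac ua]; have [_ _] := ca a ac; apply.
(* [l] orders the vertices of [e], whose positions become variables below [k]. A shared vertex will
   be put first, because [0] is the answer variable of a name. *)
have go (l : seq nat) : perm_eq l e -> let nu u := index u l in
    let d := map (brename nu) c in
    [/\ cq_name d \in names m.+1, (forall a, a \in d -> a \in atoms ar k (names b)),
      size d <= b, d <> [::] &
      (forall a, a \in d -> batom_holds I U N (nth 0 l) a)].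
  move=> le nu d.
  have nuk u : u \in bvars c -> nu u < k.
    move=> /ce; rewrite -(perm_mem le) -index_mem => lt; apply: leq_trans lt _.
    by rewrite (perm_size le).
  have nm a : a \in c -> named ar (names m) a by move=> /ca[].
  have szd : size d <= b by rewrite size_map.
  split=> //.
  - by apply: cq_name_names => //; exact: brename_atoms nm.
  - apply: brename_atoms => // a ac; apply: named_mono (nm a ac); exact: ltnW.
  - by rewrite /d; case: (c) c0.
  - move=> _ /mapP[a ac ->]; apply/brename_holds; have [_ ha ae] := ca a ac.
    apply: eq_batom_holds ha => x /ae; rewrite -(perm_mem le) => xl /=.
    by rewrite nth_index.
have back J t (l : seq nat) : (forall a, a \in map (brename (index^~ l)) c -> sem P J t a) ->
    forall a, a \in c -> sem P J (fun u => t (index u l)) a.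
  by move=> H a ac; have /brename_holds := H _ (map_f _ ac).
have [[v [vc sv]]|no] := classic (exists v, v \in bvars c /\ sp v).
  have ve := ce v vc; pose l := v :: rem v e.
  have le : perm_eq l e by rewrite perm_sym perm_to_rem.
  have [dn da ds d0 dh] := go l le; set d := map _ c in dn da ds d0 dh.
  have inj u : u \in bvars c -> sp u -> u = v by move=> /ce uc su; exact: sp1.
  exists (BU E (cq_name d) v); split=> //=; last first.
  - split=> [u uc su|J s]; first by rewrite inE (inj u uc su).
    move/semU_cqP => [t t0 /back H]; exists (fun u => t (index u l)); split=> // u uc su.
    by rewrite (inj u uc su) /= eqxx t0.
  - by move=> u; rewrite inE => /eqP ->.
  - by move=> u; rewrite inE => /eqP ->.
  have [hh _] := names_heads (leqW mb) dn.
  have := narrow_rule_holds (s := nth 0 l) hh ds d0 da _ (@cq_sound_U _) dh; apply.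
  move=> _ _ [_ <-]; move/bvarsP: vc => [a ac va].
  apply: (mem_bvars (map_f _ ac)); rewrite brename_vars.
  by apply/mapP; exists v => //=; rewrite eqxx.
have [dn da ds d0 dh] := go e (perm_refl _); set d := map _ c in dn da ds d0 dh.
exists (BN E (cq_name d)); split=> //=; last first.
- split=> [u uc su|J s]; first by case: no; exists u.
  move/semN_cqP => [t /back H]; exists (fun u => t (index u e)); split=> // u uc su.
  by case: no; exists u.
have [_ hh] := names_heads (leqW mb) dn.
by have := narrow_rule_holds (s := nth 0 e) hh ds d0 da _ (@cq_sound_N _) dh; apply.
Qed.

(** The elements of [I] double as the variables of the query [c], so that a removal can be undone in
    every instance [J]: this is what makes the final rule sound. The root [w] is kept to the end
    because the head of the rule may speak about it. With [n] edges left and names of level [m], the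
    bound [m + n <= b] keeps all names within level [b]. *)
Lemma eliminate n m F c w : size F = n -> m + n <= b -> uniq F -> {subset F <= G} ->
  size c <= b ->
  (forall a, a \in c -> [/\ named ar (names m) a, holds a &
     {subset batom_vars a <= [:: w]} \/ exists2 e, e \in F & {subset batom_vars a <= e}]) ->
  exists c', [/\ size c' <= b /\ (c <> [::] -> c' <> [::]),
    forall a, a \in c' -> [/\ named ar (names b) a, holds a & {subset batom_vars a <= [:: w]}],
    {subset bvars c' <= bvars c}, (w \in bvars c -> w \in bvars c') &
    forall J s, (forall a, a \in c' -> sem P J s a) ->
      exists t, t w = s w /\ forall a, a \in c -> sem P J t a].
Proof.
elim: n m F c => [|n IH] m F c szF mn uF sF szc ca.
  exists c; split=> //; last by move=> J s H; exists s.
  move=> a /ca [na ha [aw|[e]]]; last by rewrite (size0nil szF).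
  split=> //; apply: named_mono na; by rewrite addn0 in mn.
have F0 : F <> [::] by case: (F) szF.
have szFb : size F <= b by rewrite szF (leq_trans _ mn) // leq_addl.
have [e eF eP] := gG w uF sF F0 szFb.
pose inside (a : batom E) := all [in e] (batom_vars a).
set ce := [seq a <- c | inside a]; set cr := [seq a <- c | ~~ inside a].
have szr : size (rem e F) = n by rewrite size_rem // szF.
have uFr : uniq (rem e F) by apply: rem_uniq.
have sFr : {subset rem e F <= G} by move=> x /mem_rem /sF.
have cr_rest a : a \in cr -> {subset batom_vars a <= [:: w]} \/
    exists2 e', e' \in rem e F & {subset batom_vars a <= e'}.
  rewrite mem_filter => /andP[/negP ni /ca [_ _ [|[e' e'F ae']]]]; first by left.
  right; exists e' => //; rewrite (mem_rem_uniq _ uF) !inE e'F andbT.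
  by apply/eqP => E'; apply: ni; apply/allP => x /ae'; rewrite E'.
have cr_sp a u : a \in cr -> u \in batom_vars a -> u \in e -> touched F e w u.
  move=> /cr_rest [aw|[e' e'F ae']] ua ue; first by left; have := aw u ua; rewrite inE => /eqP.
  right; exists e'; move: e'F; rewrite (mem_rem_uniq _ uF) !inE => /andP[/eqP ne e'F].
  by split=> //; exact: ae'.
have c_split a : (a \in c) = (a \in ce) || (a \in cr).
  by rewrite !mem_filter; case: (inside a); rewrite /= ?orbF.
have [ce0|ce0] := eqVneq ce [::].
  have [||c' [h1 h2 h3 h4 h5]] := IH m (rem e F) c szr _ uFr sFr szc.
  - by rewrite (leq_trans _ mn) // leq_add2l leqnSn.
  - move=> a ac; have [na ha _] := ca a ac; split=> //.
    by apply: cr_rest; move: ac; rewrite c_split ce0.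
  by exists c'.
have mb : m < b by rewrite (leq_trans _ mn) // -addn1 leq_add2l.
have szce : size ce <= b by rewrite size_filter (leq_trans (count_size _ _)).
have ce_ok a : a \in ce -> [/\ named ar (names m) a, holds a & {subset batom_vars a <= e}].
  by rewrite mem_filter => /andP[/allP ae /ca []].
have [a0 [n0 ho0 v0 s0 [sp0 sem0]]] := absorb mb (sF _ eF) (elimN eqP ce0) szce ce_ok eP.
have ce_e u : u \in bvars ce -> u \in e.
  by move=> /bvarsP[a /ce_ok [_ _ ae] /ae].
have [|||c' [[h1 h1'] h2 h3 h4 h5]] := IH m.+1 (rem e F) (a0 :: cr) szr _ uFr sFr.
- by rewrite addSnnS.
- rewrite /=; apply: leq_trans szc; rewrite -(count_predC inside c) -!size_filter.
  by rewrite -add1n leq_add2r lt0n size_eq0.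
- move=> a; rewrite inE => /orP[/eqP ->|acr]; last first.
    have /ca [na ha _] : a \in c by rewrite c_split acr orbT.
    split=> //; [exact: named_mono na|exact: cr_rest].
  split=> //; have [->|[u ua]] : batom_vars a0 = [::] \/ exists u, u \in batom_vars a0.
  + by case: (batom_vars a0) => [|x l]; [left|right; exists x; exact: mem_head].
  + by left.
  have only x : x \in batom_vars a0 -> x = u.
    by move=> xa; apply: eP; [apply: ce_e; exact: v0|apply: ce_e; exact: v0|exact: s0|exact: s0].
  case: (s0 u ua) => [uw|[e' [e'F ne ue']]].
    by left=> x /only ->; rewrite uw inE.
  right; exists e'; last by move=> x /only ->.
  by rewrite (mem_rem_uniq _ uF) !inE e'F andbT; apply/eqP.
exists c'; split=> //; first by split=> // _; exact: h1'.
- move=> x /h3 /bvarsP[a]; rewrite inE => /orP[/eqP ->|acr] xa; last first.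
    by apply: (mem_bvars (a := a)) => //; rewrite c_split acr orbT.
  move/bvarsP: (v0 x xa) => [a' a'ce xa']; apply: (mem_bvars (a := a')) => //.
  by rewrite c_split a'ce.
- move=> /bvarsP[a]; rewrite c_split => /orP[ace|acr] wa; apply: h4; last first.
    by apply: mem_bvars wa; rewrite inE acr orbT.
  apply: (mem_bvars (mem_head _ _)); apply: sp0; last by left.
  exact: mem_bvars wa.
move=> J s /h5 [t [tw tc]].
have [t' [t'1 t'2]] := sem0 J t (tc _ (mem_head _ _)).
(* The witnesses [t'] of the new name take over on the removed atoms; they agree with [t] on all
   shared vertices. *)
exists (fun u => if u \in bvars ce then t' u else t u); split.
  by case: ifP => // wc; rewrite t'1 //; left.
move=> a; rewrite c_split => /orP[ace|acr].
  by apply: eq_batom_holds (t'2 a ace) => u ua; rewrite (mem_bvars ace ua).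
have := tc a; rewrite inE acr orbT => /(_ isT); apply: eq_batom_holds => u ua.
case: ifP => // uc; rewrite t'1 //; apply: cr_sp ua _ => //; exact: ce_e.
Qed.

Definition ground (s : nat -> nat) (a : batom E) : batom E :=
  match a with
  | BE R xs => BE R (map s xs) | BU p x => BU E p.*2 (s x) | BN p => BN E p.*2
  end.

Lemma ground_vars s a : batom_vars (ground s a) = map s (batom_vars a).
Proof. by case: a. Qed.

Definition double_head (h : hatom) : hatom :=
  match h with HU p _ => HU p.*2 0 | HN p => HN p.*2 | HGoal => HGoal end.

(** The matched body, read as a query over elements of [I], shrinks by elimination to atoms about
    [w] alone, and a rule with at most one variable derives the head. Intersecting with [adom I]
    puts the argument of each unary atom into some edge. *)
Lemma narrow_model r : List.In r P ->
  rule_sat I (fun p x => U p.*2 x /\ x \in adom I) (fun p => N p.*2) Q r.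
Proof.
move=> rP s bs; have [wf sz1] := P_wf; have := sz1 r rP.
case Eh : (Defs.head r) => [|h [|]] // _; exists h; split; first by left.
have rb : body r <> [::] by have [] := wf r rP.
(* Under a nullary head no vertex has to survive, and the root is arbitrary. *)
pose w := if h is HU _ x then s x else 0.
pose c := map (ground s) (body r).
have cP a : a \in c -> exists2 a', List.In a' (body r) & a = ground s a'.
  by move=> /InP /In_map [a' [<- H]]; exists a'.
have c_adom x : x \in bvars c -> x \in adom I.
  move=> /bvarsP[_ /cP[a ab ->]]; rewrite ground_vars => /mapP[y ya ->].
  have := bs a ab; case: a ab ya => //= [R xs|p z] ab ya.
    by move=> fI; apply: (mem_adom fI); exact: map_f.
  by case=> _; move: ya; rewrite inE => /eqP ->.
(* One edge is chosen for each atom, so [F] has at most [b] edges and the girth bound applies to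
   it. *)
pose pk (a : batom E) := nth [::] G (find (fun e => all [in e] (batom_vars a)) G).
pose F := [seq e <- undup (map pk c) | e \in G].
have szc : size c <= b by rewrite size_map; exact: b_ge.
have szF : size F <= b.
  by rewrite size_filter (leq_trans (count_size _ _)) // (leq_trans (size_undup _)) // size_map.
have pkP a : a \in c -> (exists2 e, e \in G & {subset batom_vars a <= e}) ->
    exists2 e, e \in F & {subset batom_vars a <= e}.
  move=> ac [e eG ae]; have hs : has (fun e => all [in e] (batom_vars a)) G.
    by apply/hasP; exists e => //; apply/allP.
  exists (pk a); last by apply/allP; exact: (nth_find [::] hs).
  by rewrite mem_filter mem_undup map_f // andbT /pk mem_nth // -has_find.
have nm0 a : List.In a (body r) -> named ar (names 0) (ground s a).
  move=> ab; have [_ [arr _]] := wf r rP; case: a ab => /= [R xs|p x|p] ab.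
  - by rewrite size_map; exact: arr.
  - by apply: map_f; apply: (idb_names_body rP ab); rewrite inE.
  - by apply: map_f; apply: (idb_names_body rP ab); rewrite inE.
have [|||a|c' [[h1 h1'] h2 h3 h4 h5]] := @eliminate (size F) 0 F c w erefl szF.
- by rewrite filter_uniq // undup_uniq.
- by move=> e; rewrite mem_filter => /andP[].
- exact: szc.
- move=> ac; have [a' ab aE] := cP a ac; split.
  + by rewrite aE; exact: nm0.
  + have := bs a' ab; rewrite aE; case: (a') => //= [R xs|p x []] //.
    by rewrite map_id.
  have [vs0|vs0] := eqVneq (batom_vars a) [::]; first by left; rewrite vs0.
  right; apply: pkP => //; have := bs a' ab; move: vs0; rewrite aE.
  case: (a') => //= [R xs _ /G_cover //|p x _ [_ /adomP[f fI xf]]].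
  have [e eG fe] := G_cover fI; exists e => // y; rewrite inE => /eqP ->; exact: fe.
have {h1'} c'0 : c' <> [::] by apply: h1'; rewrite /c; case: (body r) rb.
pose d := map (brename (fun=> 0)) c'.
have dP a : a \in d -> exists2 a', a' \in c' & a = brename (fun=> 0) a' by move/mapP.
have dh a : a \in d -> batom_holds I U N (fun=> w) a.
  move=> /dP[a' ac ->]; have [_ ha aw] := h2 a' ac.
  apply/brename_holds; apply: eq_batom_holds ha => x /aw /=; by rewrite inE => /eqP.
have d_atoms a : a \in d -> a \in atoms ar k (names b).
  apply: brename_atoms; last by move=> x /h2 [].
  move=> u /h3 /c_adom /adomP[f fI uf]; have [e eG fe] := G_cover fI.
  have [_ le] := G_ok eG; apply: leq_trans le; have := fe u uf; by case: (e).
have hbody p x : h = HU p x -> x \in body_vars r.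
  by move=> E0; have [_ [_ [H _]]] := wf r rP; apply: (H p); rewrite Eh E0; left.
have w_c p x : h = HU p x -> w \in bvars c.
  move=> E0; have := hbody p x E0 => /flatten_In[a ab xa].
  apply/bvarsP; exists (ground s a); first by apply/InP/In_map; exists a.
  by rewrite ground_vars /w E0 map_f.
have so : sound P (Rule [:: double_head h] d).
  move=> J t ds; exists (double_head h); split; first by left.
  have [|t3 [t3w t3c]] := h5 J (fun=> t 0).
    move=> a ac; have /= := ds (brename (fun=> 0) a); move/(_ _)/brename_holds; apply.
    by apply/InP/map_f.
  have [|h' [h'r hh]] := least_model (I := J) sz1 rP (s := t3 \o s).
    move=> a ab; have : ground s a \in c by apply/InP/In_map; exists a.
    move=> /t3c; rewrite /sem; case: (a) => /= [R xs|p x|p].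
    + by rewrite -map_comp.
    + exact: semU_baseE.
    + exact: semN_baseE.
  move: h'r hh; rewrite Eh => -[<-|//].
  move: t3w; rewrite /w; case: (h) => //= [p x E0|p _] H.
    by rewrite -E0; exact: semU_base.
  exact: semN_base.
have hh : List.In (double_head h) (heads (names b.+1)).
  have nmh p : p \in hname h -> p.*2 \in names 0.
    by move=> ph; apply: map_f; apply: (idb_names_head rP _ ph); rewrite Eh; left.
  case: (h) nmh => [p x|p|] nmh; last by left.
  + by have [] := names_heads (leq0n _) (nmh p (mem_head _ _)).
  + by have [] := names_heads (leq0n _) (nmh p (mem_head _ _)).
have := narrow_rule_holds (s := fun=> w) hh (c := d) _ _ d_atoms _ so dh.
rewrite size_map => /(_ h1); move=> X.
have {X} : hatom_holds U N Q (fun=> w) (double_head h).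
  apply: X; first by rewrite /d; case: (c') c'0.
  move=> p x; case Eh' : h => [q y|q|] //= [_ <-].
  move/w_c: Eh' => /h4 /bvarsP[a ac wa]; apply: (mem_bvars (map_f _ ac)).
  by rewrite brename_vars; apply/mapP; exists w.
case Eh' : h => [q y|q|] //=; rewrite /w Eh' => H; split=> //.
by apply: c_adom; have := w_c _ _ Eh'; rewrite /w Eh'.
Qed.
End Completeness.

Section MDLogRewriting.
Variables (E : finType) (ar : E -> nat).

Theorem mdlog_narrow (Pi : program E) k : wf_mddlog ar Pi -> diameter Pi = k ->
  MDLog_rewritable ar Pi -> exists Pi' : program E,
       wf_mdlog ar Pi' /\ diameter Pi' <= k /\
       is_rewriting ar (fun I => prog_entails I Pi') Pi.
Proof.
move=> wf dk [P [Pwf rw]]; pose b := \max_(r <- P) size (body r).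
have b_ge r : List.In r P -> size (body r) <= b.
  rewrite /b; elim: (P) => //= r' P' IH; rewrite big_cons => -[->|/IH le].
    exact: leq_maxl.
  exact: leq_trans (leq_maxr _ _).
exists (narrow ar P k b); split; first exact: narrow_wf.
split=> [|I Iwf]; first exact: narrow_diameter.
split=> [/narrow_sound|]; first by move=> H; apply/(rw I Iwf).
have dk' : diameter Pi <= k by rewrite dk.
have [I' [G [pi [gG G_ok G_cover I'wf [hpi tr]]]]] := sparse_lift b wf dk' Iwf.
move=> /tr /(rw I' I'wf) HP; apply: (entails_hom hpi) => U N Q mod.
by apply: HP (narrow_model Pwf b_ge gG G_ok G_cover mod).
Qed.
End MDLogRewriting.

(** * The Ehrenfeucht-Fraisse game *)

Section Near.
Variable G : seq (seq nat).

(** Distance at most [n], two vertices being adjacent when some edge contains both. *)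
Fixpoint near n x y : bool :=
  if n is m.+1 then near m x y || has (fun e => (y \in e) && has (near m x) e) G else x == y.

Lemma near_refl n x : near n x x.
Proof. by elim: n => [|n IH] /=; rewrite ?eqxx ?IH. Qed.

Lemma near_mono m n x y : m <= n -> near m x y -> near n x y.
Proof. by move=> /subnK <-; elim: (n - m) => //= d IH /IH ->. Qed.

Lemma near_trans m n x y z : near m x y -> near n y z -> near (m + n) x z.
Proof.
move=> xy; elim: n z => [|n IH] z /=; first by move/eqP <-; rewrite addn0.
rewrite addnS /= => /orP[/IH -> //|/hasP[e eG /andP[ze /hasP[u ue /IH xu]]]].
by apply/orP; right; apply/hasP; exists e => //; rewrite ze; apply/hasP; exists u.
Qed.

Lemma near_edge e x y : e \in G -> x \in e -> y \in e -> near 1 x y.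
Proof.
move=> eG xe ye; apply/orP; right; apply/hasP; exists e => //=.
by rewrite ye; apply/hasP; exists x.
Qed.

Lemma near_sym n x y : near n x y -> near n y x.
Proof.
elim: n y => [|n IH] y /=; first by rewrite eq_sym.
move=> /orP[/IH -> //|/hasP[e eG /andP[ye /hasP[u ue /IH ux]]]].
exact: near_trans (near_edge eG ye ue) ux.
Qed.
End Near.

Fixpoint qrank (E : finType) (f : fo E) : nat :=
  match f with
  | FEq _ _ | FAtom _ _ => 0
  | FNot g => qrank g
  | FAnd g h => maxn (qrank g) (qrank h)
  | FEx _ g => (qrank g).+1
  end.

Section Game.
Variables (E : finType) (I : instance E) (G : seq (seq nat)).
Hypothesis G_cover : forall f, f \in I -> exists2 e, e \in G & {subset f.2 <= e}.
Variables (T : countType) (D : T -> pred nat).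

Definition pt_code (i : T) (x : nat) : nat := pickle (i, x).

Lemma pt_code_inj i x j y : pt_code i x = pt_code j y -> i = j /\ x = y.
Proof. by move=> /(pcan_inj (@pickleK _)) [-> ->]. Qed.

Definition pieces (P : seq T) : instance E :=
  [seq (f.1, map (pt_code i) f.2) | i <- P, f <- [seq f <- I | all (D i) f.2]].

Lemma piecesP P R xs : reflect (exists i ys, [/\ i \in P, (R, ys) \in I, all (D i) ys &
   xs = map (pt_code i) ys]) ((R, xs) \in pieces P).
Proof.
apply: (iffP allpairsPdep) => [[i [f [iP]]]|[i [ys [iP yI yD ->]]]].
  by rewrite mem_filter => /andP[fD fI] [-> ->]; exists i, f.2; split => //; case: (f) fI.
by exists i, (R, ys); rewrite mem_filter yD.
Qed.

Lemma adom_pieces P a : reflect (exists i x f, [/\ i \in P, f \in I, x \in f.2, all (D i) f.2 &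
   a = pt_code i x]) (a \in adom (pieces P)).
Proof.
apply: (iffP (adomP _ _)) => [[[R xs] /piecesP[i [ys [iP yI yD ->]]] /mapP[x xy ->]]|].
  by exists i, x, (R, ys).
move=> [i [x [[R ys] [iP yI xy yD ->]]]]; exists (R, map (pt_code i) ys); last exact: map_f.
by apply/piecesP; exists i, ys.
Qed.

Variables (r n : nat).

(** [L] stands for the pieces already in use: a fresh answer remains available as long as fewer than
    [n] points have been played. *)
Definition extends (P P' : seq T) := forall i x d (L : seq T), i \in P -> x \in adom I ->
  d <= r -> size L < n ->
  exists i', [/\ i' \in P', i' \notin L & forall y, near G (2 ^ d) x y -> D i y = D i' y].

(* The two players always pick the same point [pt v] of [I], in pieces [ip v] and
   [iq v] that agree around it. *)
Definition matched (P P' : seq T) d (V : seq nat) (s t : nat -> nat) :=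
  exists (ip iq : nat -> T) (pt : nat -> nat),
    (forall v, v \in V -> [/\ s v = pt_code (ip v) (pt v) /\ t v = pt_code (iq v) (pt v),
       ip v \in P, iq v \in P' &
       forall y, near G (2 ^ d) (pt v) y -> D (ip v) y = D (iq v) y]) /\
    (forall v w, v \in V -> w \in V -> near G (2 ^ d) (pt v) (pt w) ->
       (ip v == ip w) = (iq v == iq w)).

Lemma matched_sym P P' d V s t : matched P P' d V s t -> matched P' P d V t s.
Proof.
move=> [ip [iq [pt [H1 H2]]]]; exists iq, ip, pt; split.
  by move=> v /H1 [[-> ->] h1 h2 h3]; split => // y /h3.
by move=> v w vV wV /(H2 v w vV wV).
Qed.

Lemma near1 d x y : near G 1 x y -> near G (2 ^ d) x y.
Proof. by apply: near_mono; rewrite expn_gt0. Qed.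

Lemma near_double d x y z : near G (2 ^ d) x y -> near G (2 ^ d) y z -> near G (2 ^ d.+1) x z.
Proof. by move=> xy yz; rewrite expnS mul2n -addnn; exact: near_trans xy yz. Qed.

(** A point close to an earlier one of the same piece is answered in the partner of that piece, any
    other point in a fresh piece. Halving the radius in each round leaves room for the triangle
    inequality [near_double]. *)
Lemma matched_step P P' d V s t x a : extends P P' -> matched P P' d.+1 V s t ->
  d <= r -> size V < n -> a \in adom (pieces P) ->
  exists2 a', a' \in adom (pieces P') & matched P P' d (x :: V) (upd s x a) (upd t x a').
Proof.
move=> ext [ip [iq [pt [H1 H2]]]] dr Vn /adom_pieces[i [y [f [iP fI yf fD ->]]]].
have yI : y \in adom I by apply: mem_adom fI yf.
have [i' [i'P i'D i'V]] : exists i', [/\ i' \in P',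
    forall z, near G (2 ^ d) y z -> D i z = D i' z &
    forall v, v \in V -> near G (2 ^ d) y (pt v) -> (i == ip v) = (i' == iq v)].
  have [[w [wV iw yw]]|no] := classic (exists w, [/\ w \in V, ip w = i &
      near G (2 ^ d) (pt w) y]).
    have [_ _ iqP wD] := H1 w wV; exists (iq w); split => //.
      by move=> z yz; rewrite -iw; apply: wD; exact: near_double yz.
    by move=> v vV yv; rewrite -iw; apply: H2 => //; exact: near_double yv.
  have [|i' [i'P i'L i'D]] := ext i y d (map iq V) iP yI dr; first by rewrite size_map.
  exists i'; split => // v vV yv; rewrite [i' == _]negbTE; last first.
    by apply: contra i'L => /eqP ->; exact: map_f.
  by apply/eqP => E'; apply: no; exists v; split => //; exact: near_sym.
have all_D z : z \in f.2 -> D i z = D i' z.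
  move=> zf; apply: i'D; apply: near1; have [e eG fe] := G_cover fI.
  by apply: (near_edge eG); exact: fe.
exists (pt_code i' y).
  apply/adom_pieces; exists i', y, f; split => //.
  by apply/allP => z zf; rewrite -all_D //; exact: (allP fD).
pose ins A (g : nat -> A) c v := if v == x then c else g v.
exists (ins _ ip i), (ins _ iq i'), (ins _ pt y); split.
  move=> v; rewrite inE /ins /upd; case: eqP => //= _ vV.
  have [h1 h2 h3 h4] := H1 v vV; split => // z /near_mono h; apply: h4; apply: h.
  by rewrite leq_exp2l.
have mono u z : near G (2 ^ d) u z -> near G (2 ^ d.+1) u z.
  by apply: near_mono; rewrite leq_exp2l.
move=> v w; rewrite !inE /ins.
case: (v =P x) => [_|_] /= vV; case: (w =P x) => [_|_] /= wV; rewrite ?eqxx //.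
- exact: i'V.
- by move=> /near_sym yv; rewrite eq_sym [RHS]eq_sym; exact: i'V.
- by move=> /mono; exact: H2.
Qed.

(** The arguments of a fact are pairwise adjacent, so their answers share one piece. A nullary fact
    lies in every piece, which is why [P'] must contain one. *)
Lemma matched_atom P P' d V s t R xs : P' != [::] -> matched P P' d V s t ->
  {subset xs <= V} -> (R, map s xs) \in pieces P -> (R, map t xs) \in pieces P'.
Proof.
case: P' => // i0 P' _ [ip [iq [pt [H1 H2]]]] sub /piecesP[i [ys [iP yI yD E1]]].
have xsP x : x \in xs -> ip x = i /\ s x = pt_code i (pt x).
  move=> xx; have [[sx _] _ _ _] := H1 x (sub x xx).
  have : s x \in map s xs by exact: map_f.
  by rewrite E1 => /mapP[y _]; rewrite sx => /pt_code_inj [-> _].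
have ysE : ys = map pt xs.
  have : map (pt_code i) ys = map (pt_code i) (map pt xs).
    by rewrite -E1 -map_comp; apply/eq_in_map => x /xsP [].
  by apply: inj_map => y z /pt_code_inj [].
case Exs : xs => [|x0 xs'].
  by apply/piecesP; exists i0, [::]; rewrite mem_head; split => //; rewrite ysE Exs in yI.
rewrite -Exs; have x0x : x0 \in xs by rewrite Exs mem_head.
have nr x : x \in xs -> near G (2 ^ d) (pt x0) (pt x).
  move=> xx; apply: near1; have [e eG fe] := G_cover yI; rewrite ysE in fe.
  by apply: (near_edge eG); apply: fe; exact: map_f.
have iqE x : x \in xs -> iq x = iq x0.
  move=> xx; apply/eqP; rewrite eq_sym -(H2 x0 x (sub _ x0x) (sub _ xx) (nr _ xx)).
  by rewrite (proj1 (xsP _ x0x)) (proj1 (xsP _ xx)).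
have [_ _ i0P x0D] := H1 x0 (sub _ x0x).
apply/piecesP; exists (iq x0), ys; split => //.
  rewrite ysE; apply/allP => _ /mapP[x xx ->]; rewrite -x0D; last exact: nr.
  rewrite (proj1 (xsP _ x0x)); apply: (allP yD); rewrite ysE; exact: map_f.
rewrite ysE -map_comp; apply/eq_in_map => x xx /=.
by have [[_ ->] _ _ _] := H1 x (sub _ xx); rewrite iqE.
Qed.

Lemma game (f : fo E) d V s t P P' : P != [::] -> P' != [::] -> extends P P' -> extends P' P ->
  {subset fv f <= V} -> qrank f <= d -> d <= r -> size V + d <= n -> matched P P' d V s t ->
  fo_sat (pieces P) s f -> fo_sat (pieces P') t f.
Proof.
elim: f d V s t P P' => [x y|R xs|g IH|g IHg h IHh|x g IH] d V s t P P' P0 P'0 e1 e2 sub qd dr szV m /=.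
- have [ip [iq [pt [H1 H2]]]] := m.
  have xV : x \in V by apply: sub; rewrite !inE eqxx.
  have yV : y \in V by apply: sub; rewrite !inE eqxx orbT.
  have [[-> ->] _ _ _] := H1 x xV; have [[-> ->] _ _ _] := H1 y yV.
  move=> /pt_code_inj [Ei Ep]; congr pt_code => //; apply/eqP.
  by rewrite -H2 ?Ei // Ep near_refl.
- exact: matched_atom m _.
- by move=> ns /(IH d V _ _ P' P) X; apply: ns; apply: X => //; exact: matched_sym.
- move: qd; rewrite /= geq_max => /andP[qg qh] [sg sh]; split.
    by apply: (IHg d V) sg => // v vg; apply: sub; rewrite mem_cat vg.
  by apply: (IHh d V) sh => // v vg; apply: sub; rewrite mem_cat vg orbT.
move=> [a [aP sa]]; case: d qd dr szV m => // d qd dr szV m.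
have szV' : size V < n by rewrite (leq_trans _ szV) // -addn1 leq_add2l.
have [a' a'P m'] := matched_step x e1 m (ltnW dr) szV' aP.
exists a'; split => //; apply: (IH d (x :: V) _ _ _ _ _ _ e1 e2 _ _ _ _ m') sa => //.
- move=> v vg; rewrite inE; case: eqP => //= /eqP vx; apply: sub.
  by rewrite /= mem_filter vx.
- exact: ltnW.
- by rewrite /= addSnnS.
Qed.
End Game.

(** * Trees and forests *)

Section ParentTree.
Variables (n : nat) (par : nat -> nat).
Hypothesis par_lt : forall v, 0 < v -> par v < v.

Definition parent_rel : rel 'I_n.+1 :=
  fun u v => ((0 < u) && (par u == v)) || ((0 < v) && (par v == u)).

Lemma parent_rel_sym : symmetric parent_rel.
Proof. by move=> u v; rewrite /parent_rel orbC. Qed.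

Lemma parent_rel_lt u v : parent_rel u v -> v < u -> par u = v.
Proof.
move=> /orP[/andP[_ /eqP //]|/andP[v0 /eqP vu]] lt.
by have := ltn_trans (par_lt v0) lt; rewrite vu ltnn.
Qed.

(** On a cycle, the vertex of largest index would have two distinct smaller neighbours, but both
    must be its parent. *)
Lemma parent_tree : is_tree parent_rel.
Proof.
split => //; split; [|split; [exact: parent_rel_sym|split]].
- move=> u; rewrite /parent_rel orbb; apply/negP => /andP[/par_lt lt /eqP E].
  by rewrite E ltnn in lt.
- have root u : connect parent_rel u ord0.
    have [m] := ubnP (val u); elim: m u => // m IH u um.
    have [->|u0] := eqVneq u ord0; first exact: connect0.
    have u0' : 0 < u by rewrite lt0n; apply: contra u0 => /eqP u0; apply/eqP/val_inj.
    have ltp := par_lt u0'; pose w : 'I_n.+1 := Ordinal (ltn_trans ltp (ltn_ord u)).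
    apply: (connect_trans (y := w)); first by apply: connect1; rewrite /parent_rel u0' eqxx.
    by apply: IH; rewrite (leq_trans ltp).
  move=> u v; apply: connect_trans (root u) _.
  by rewrite (sym_connect_sym parent_rel_sym).
move=> x p uxp szp pp; apply/negP => lx.
have cyc : cycle parent_rel (x :: p) by rewrite /= rcons_path pp.
have [m mxp mmax] : exists2 m, m \in x :: p & forall y, y \in x :: p -> y <= m.
  case: (@arg_maxnP _ x [in x :: p] (fun y : 'I_n.+1 => val y) (mem_head _ _)) => m mxp mmax.
  by exists m => // y; exact: mmax.
have [i q rq] := rot_to mxp.
have : cycle parent_rel (m :: q) by rewrite -rq rot_cycle.
have uq : uniq (m :: q) by rewrite -rq rot_uniq.
have szq : size q = size p by have := congr1 size rq; rewrite size_rot => -[].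
have lt y : y \in q -> y < m.
  move=> yq; rewrite ltn_neqAle mmax ?andbT; last by rewrite -(mem_rot i) rq inE yq orbT.
  by apply: contraTneq yq => /val_inj ->; have /andP[] := uq.
case: q {rq} uq szq lt => [|y [|z q]] uq szq lt; rewrite -?szq // in szp.
rewrite /cycle rcons_path => /andP[/= /andP[my _] lm].
have Ey := parent_rel_lt my (lt y (mem_head _ _)).
have lq : last z q \in y :: z :: q by rewrite inE mem_last orbT.
have El : par m = last z q by apply: parent_rel_lt; [rewrite parent_rel_sym|exact: lt].
move: uq; rewrite /= => /and3P[_ /negP yn _]; apply: yn.
have -> : y = last z q by apply: val_inj; rewrite /= -Ey.
exact: mem_last.
Qed.
End ParentTree.

(** A hyperforest given by an elimination order: each bag is attached to the later ones in at most
    one element. *)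
Fixpoint forest (bs : seq (seq nat)) : Prop :=
  if bs is b :: bs' then
    (forall u v, u \in b -> v \in b -> u \in flatten bs' -> v \in flatten bs' -> u = v) /\
    forest bs'
  else True.

Section ForestTreewidth.
Variable E : finType.

Lemma forest_treewidth k (I : instance E) bs : forest bs -> (forall b, b \in bs -> size b <= k) ->
  (forall f, f \in I -> f.2 != [::] -> exists2 b, b \in bs & {subset f.2 <= b}) ->
  has_treewidth 1 k I.
Proof.
(* After reversal a bag comes after those it is attached to. The empty bag in front is the parent of
   bags that meet no earlier one, and keeps the tree nonempty. *)
move=> fbs szbs cov; pose Bs : seq (seq nat) := [::] :: rev bs; pose nb v := nth [::] Bs v.
have nbP v : nb v = [::] \/ nb v \in bs.
  case: v => [|v]; first by left.
  rewrite /nb /Bs /=; case: (ltnP v (size (rev bs))) => h; last by left; rewrite nth_default.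
  by right; rewrite -mem_rev mem_nth.
have one v x y u u' : x \in nb v -> y \in nb v -> u < v -> u' < v ->
    x \in nb u -> y \in nb u' -> x = y.
  rewrite /nb /Bs {nbP szbs cov nb Bs}.
  elim: bs fbs v => [_ v|b bs IH [fb fbs] v]; first by case: v => [|[|v]].
  rewrite rev_cons -!rcons_cons !nth_rcons /=.
  case: (ltngtP v (size (rev bs)).+1) => // [lt|->].
    move=> xv yv uv u'v; rewrite !(ltn_trans _ lt) //; exact: IH xv yv uv u'v.
  have inb w z : z \in nth [::] ([::] :: rev bs) w -> z \in flatten bs.
    move=> zn; apply/flattenP; exists (nth [::] ([::] :: rev bs) w) => //.
    case: w zn => [|w] //=; case: (ltnP w (size (rev bs))) => h; last by rewrite nth_default.
    by move=> _; rewrite -(mem_rev bs) mem_nth.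
  move=> xb yb -> -> /inb xn /inb yn; exact: fb.
pose meets v (c : seq nat) := has [in c] (nb v).
pose par v := let u := find (meets v) (take v Bs) in if u < v then u else 0.
(* The first earlier bag that meets bag [v] is a good parent: bag [v] shares only one element with
   all earlier bags together, so the parent contains it. *)
have par_lt v : 0 < v -> par v < v by rewrite /par /=; case: ifP.
have parP v a u : u < v -> v < size Bs -> a \in nb v -> a \in nb u -> a \in nb (par v).
  move=> uv vs av au; have szt : size (take v Bs) = v by rewrite size_takel // ltnW.
  have h : has (meets v) (take v Bs).
    apply/hasP; exists (nb u); last by apply/hasP; exists a.
    by rewrite /nb -(nth_take _ uv) mem_nth // szt.
  have lt : find (meets v) (take v Bs) < v by move: h; rewrite has_find szt.
  rewrite /par /= lt; have := nth_find [::] h; rewrite nth_take // => /hasP[y yv yp].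
  by rewrite (one v a y u _ av yv uv lt au yp).
pose n := size bs; have szB : size Bs = n.+1 by rewrite /= size_rev.
pose B (v : 'I_n.+1) := undup [seq x <- nb v | x \in adom I].
have BE v x : (x \in B v) = (x \in adom I) && (x \in nb v) by rewrite mem_undup mem_filter.
exists n.+1, (@parent_rel n par), B; split; [|split].
- split; first exact: parent_tree.
  split; first by move=> v; split; [exact: undup_uniq|move=> x; rewrite BE => /andP[]].
  have covB (b : seq nat) : b \in bs -> exists v : 'I_n.+1, nb v = b.
    move=> bbs; have bBs : b \in Bs by rewrite inE mem_rev bbs orbT.
    have lt : index b Bs < n.+1 by rewrite -szB index_mem.
    by exists (Ordinal lt); rewrite /nb /= nth_index.
  split; last first.
    move=> f fI; have [f0|f0] := eqVneq f.2 [::]; first by exists ord0; rewrite f0.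
    have [b /covB [v vb] fb] := cov f fI f0; exists v => x xf.
    by rewrite BE vb fb // (mem_adom fI xf).
  move=> a aI; split.
    have [f fI af] := adomP _ _ aI; have f0 : f.2 != [::] by case: (f.2) af.
    have [b /covB [v vb] fb] := cov f fI f0; exists v.
    by rewrite BE aI vb fb.
  move=> u v; rewrite !BE aI /= => au av.
  set e := (fun x y => _).
  have esym : symmetric e.
    by move=> x y; rewrite /e parent_rel_sym; case: (_ \in _); case: (_ \in _); rewrite ?andbF.
  have exm : exists m, (a \in nb m) && (m < n.+1) by exists u; rewrite au /=.
  have [m /andP[am mn] mmin] := ex_minnP exm.
  have to_m (w : 'I_n.+1) : a \in nb w -> connect e w (Ordinal mn).
    have [N] := ubnP (val w); elim: N w => // N IH w wN aw.
    have [->|wm] := eqVneq w (Ordinal mn); first exact: connect0.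
    have mw : m < w.
      rewrite ltn_neqAle mmin ?aw ?ltn_ord // andbT.
      by apply: contra wm => /eqP mw; apply/eqP/val_inj.
    have w0 : 0 < w by apply: leq_ltn_trans mw.
    have ltp := par_lt _ w0; pose w' : 'I_n.+1 := Ordinal (ltn_trans ltp (ltn_ord w)).
    have aw' : a \in nb w' by apply: (parP w a m) => //; rewrite szB.
    apply: (connect_trans (y := w')); last by apply: IH => //; rewrite (leq_trans ltp).
    by apply: connect1; rewrite /e !BE aI aw aw' /parent_rel w0 eqxx.
  apply: connect_trans (to_m u au) _.
  by rewrite (sym_connect_sym esym); exact: to_m.
- move=> u v uv; have: forall x y, x \in [seq a <- B u | a \in B v] ->
      y \in [seq a <- B u | a \in B v] -> x = y.
    move=> x y; rewrite !mem_filter !BE => /andP[/andP[_ xv] /andP[_ xu]] /andP[/andP[_ yv] /andP[_ yu]].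
    have [ltuv|gtuv|E0] := ltngtP u v; first exact: (one _ _ _ _ _ xv yv ltuv ltuv xu yu).
      exact: (one _ _ _ _ _ xu yu gtuv gtuv xv yv).
    by case/eqP: uv; exact: val_inj.
  have : uniq [seq a <- B u | a \in B v] by rewrite filter_uniq // undup_uniq.
  case: [seq _ <- _ | _] => [|x [|y l]] //= /andP[xn _] H.
  by case/negP: xn; rewrite (H x y) ?inE ?eqxx ?orbT.
- move=> v; rewrite (leq_trans (size_undup _)) // size_filter (leq_trans (count_size _ _)) //.
  by case: (nbP v) => [->|/szbs].
Qed.

End ForestTreewidth.

Fixpoint sublists (T : Type) (s : seq T) : seq (seq T) :=
  if s is x :: s' then map (cons x) (sublists s') ++ sublists s' else [:: [::]].

Lemma filter_sublists (T : eqType) (p : pred T) (s : seq T) : filter p s \in sublists s.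
Proof.
elim: s => //= x s IH; rewrite mem_cat; case: (p x); rewrite ?IH ?orbT //.
by rewrite map_f.
Qed.

Lemma sublists_sub (T : eqType) (s l : seq T) : l \in sublists s -> {subset l <= s}.
Proof.
elim: s l => [|x s IH] l /=; first by rewrite inE => /eqP ->.
rewrite mem_cat => /orP[/mapP[l' /IH sub ->]|/IH sub] y; last by move=> /sub ys; rewrite inE ys orbT.
by rewrite !inE => /orP[->//|/sub ->]; rewrite orbT.
Qed.

(** The closing bag [[:: 0]] is a placeholder for whatever the root [0] gets attached to; [X] can
    take its place because it shares at most [h 0] with the renamed bags. *)
Lemma forest_graft (h : nat -> nat) bs X : injective h -> forest (bs ++ [:: [:: 0]]) -> forest X ->
  (forall v, h v \in flatten X -> v = 0) -> forest (map (map h) bs ++ X).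
Proof.
move=> hi; elim: bs => //= b bs IH [fb fbs] fX hX; split; last exact: IH.
have back u : h u \in flatten (map (map h) bs ++ X) -> u \in flatten (bs ++ [:: [:: 0]]).
  rewrite !flatten_cat !mem_cat => /orP[|/hX ->]; last by rewrite /= orbT.
  by rewrite -map_flatten mem_map // => ->.
move=> _ _ /mapP[u ub ->] /mapP[v vb ->] /back uF /back vF; congr h; exact: fb.
Qed.

(** * Unravellings with finitely many shapes *)

Section Unravel.
Variables (E : finType) (ar : E -> nat) (k : nat).
Local Notation facts := (seq (fact E)).

Definition map_facts (h : nat -> nat) (fs : facts) : facts := [seq (f.1, map h f.2) | f <- fs].

Definition small_facts : facts :=
  flatten [seq [seq (R, xs) | xs <- seqs_upto (iota 0 k) (ar R) & size xs == ar R] | R <- enum E].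

Lemma small_factsP f : reflect (size f.2 = ar f.1 /\ forall x, x \in f.2 -> x < k)
  (f \in small_facts).
Proof.
apply: (iffP flatten_mapP) => [[R _ /mapP[xs]]|[sz lt]].
  rewrite mem_filter mem_seqs_upto => /and3P[/eqP sz _ /allP al] -> /=; split=> // x /al.
  by rewrite /= mem_iota.
exists f.1; first by rewrite mem_enum.
apply/mapP; exists f.2; last by case: (f).
rewrite mem_filter mem_seqs_upto sz eqxx leqnn /=.
by apply/allP => x /lt; rewrite /= mem_iota.
Qed.

(* A bag type: the facts of a bag, whose elements are numbered from the root [0]
   on, and the trees hanging off its elements [1, 2, ..]. *)
Definition bag_type := (facts * seq facts)%type.

(** The successor reserves [0] for the root, which all bags of a glued tree share. *)
Definition ren (b : bag_type) (i v : nat) : nat := (pickle (b, i, v)).+1.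
Definition pos (b : bag_type) (i : nat) : nat := if i is i'.+1 then ren b i' 0 else 0.

Lemma ren_inj b i v b' i' v' : ren b i v = ren b' i' v' -> [/\ b = b', i = i' & v = v'].
Proof. by move=> /eq_add_S /(pcan_inj (@pickleK _)) [-> -> ->]. Qed.

Definition glue1 (b : bag_type) : facts :=
  map_facts (pos b) b.1 ++
  flatten [seq map_facts (ren b i) (nth [::] b.2 i) | i <- iota 0 (size b.2)].

Definition glue (Z : seq bag_type) : facts := flatten (map glue1 (undup Z)).

Lemma glueP Z f : reflect (exists2 b, b \in Z &
   (exists2 g, g \in b.1 & f = (g.1, map (pos b) g.2)) \/
   (exists i g, [/\ i < size b.2, g \in nth [::] b.2 i & f = (g.1, map (ren b i) g.2)]))
  (f \in glue Z).
Proof.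
apply: (iffP flatten_mapP) => [[b]|[b bZ H]].
  rewrite mem_undup => bZ; rewrite mem_cat => /orP[/mapP[g gb ->]|/flatten_mapP[i]].
    by exists b => //; left; exists g.
  by rewrite mem_iota => /= ib /mapP[g gb ->]; exists b => //; right; exists i, g.
exists b; first by rewrite mem_undup.
rewrite mem_cat; case: H => [[g gb ->]|[i [g [ib gb ->]]]]; apply/orP; [left|right].
  by apply/mapP; exists g.
by apply/flatten_mapP; exists i; [rewrite mem_iota|apply/mapP; exists g].
Qed.

Definition bag_types (L : seq facts) : seq bag_type :=
  [seq (fs, ts) | fs <- sublists small_facts, ts <- seqs_upto L k.-1].

(** This list mentions no instance, so one finite UCQ can be formed from it for all instances. *)
Fixpoint trees j : seq facts :=
  if j is j'.+1 then map glue (sublists (bag_types (trees j'))) else [:: [::]].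

Definition rooted_forest (t : facts) := exists bs, [/\ forest (bs ++ [:: [:: 0]]),
  forall b, b \in bs -> size b <= k &
  forall f, f \in t -> f.2 != [::] -> exists2 b, b \in bs ++ [:: [:: 0]] & {subset f.2 <= b}].

Lemma bag_types_sub L b : b \in bag_types L ->
  [/\ {subset b.1 <= small_facts}, size b.2 <= k.-1 & {subset b.2 <= L}].
Proof.
move=> /allpairsP[[fs ts] /= [/sublists_sub fsP]]; rewrite mem_seqs_upto => /andP[sz /allP al] ->.
by split.
Qed.

Lemma glue_rooted_forest L Z : 0 < k -> (forall t, t \in L -> rooted_forest t) ->
  {subset Z <= bag_types L} -> rooted_forest (glue Z).
Proof.
move=> k0 LP sub.
suff [bs [fbs szbs covbs _]] : exists bs, [/\ forest (bs ++ [:: [:: 0]]),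
    forall b, b \in bs -> size b <= k,
    forall f, f \in glue Z -> f.2 != [::] -> exists2 b, b \in bs ++ [:: [:: 0]] & {subset f.2 <= b} &
    forall x, x \in flatten bs -> x = 0 \/ exists b i v, b \in undup Z /\ x = ren b i v].
  by exists bs.
have {sub} : {subset undup Z <= bag_types L} by move=> b; rewrite mem_undup => /sub.
rewrite /glue; elim: (undup Z) (undup_uniq Z) => [_ _|b Z' IH /= /andP[bZ' uZ'] sub].
  by exists [::]; split.
have [b' b'Z|bs [fbs szbs covbs verbs]] := IH uZ'.
  by apply: sub; rewrite inE b'Z orbT.
have [b1 szb2 b2] := bag_types_sub (sub b (mem_head _ _)).
(* The bag of the root and its children, padded to all [k] positions so that it holds every fact
   over variables below [k]. *)
pose pb := map (pos b) (iota 0 k).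
have [cs [fcs szcs covcs vercs]] : exists cs, [/\ forest (cs ++ pb :: bs ++ [:: [:: 0]]),
    forall c, c \in cs -> size c <= k,
    forall f, f \in flatten [seq map_facts (ren b i) (nth [::] b.2 i) | i <- iota 0 (size b.2)] ->
      exists2 c, c \in pb :: cs & {subset f.2 <= c} &
    forall x, x \in flatten cs -> exists i v, i \in iota 0 (size b.2) /\ x = ren b i v].
  have : {subset iota 0 (size b.2) <= gtn (size b.2)} by move=> i; rewrite mem_iota.
  elim: (iota 0 _) (iota_uniq 0 (size b.2)) => [_ _|i s IHs /= /andP[isn us] subs].
    exists [::]; split => //=; split => // u v.
    have pb0 x : x \in pb -> x \in flatten (bs ++ [:: [:: 0]]) -> x = 0.
      move=> /mapP[[|i] _ -> //]; rewrite flatten_cat mem_cat => /orP[/verbs|].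
        by move=> [//|[b' [i' [v' [b'Z /ren_inj [E' _ _]]]]]]; rewrite E' b'Z in bZ'.
      by rewrite inE => /eqP.
    by move=> up vp /(pb0 _ up) -> /(pb0 _ vp) ->.
  have [j js|cs [fcs szcs covcs vercs]] := IHs us; first by apply: subs; rewrite inE js orbT.
  have ib : i < size b.2 by have := subs i (mem_head _ _).
  have [ts [fts szts covts]] := LP _ (b2 _ (mem_nth [::] ib)).
  exists (map (map (ren b i)) ts ++ cs); split.
  - rewrite -catA; apply: forest_graft => //; first by move=> u v /ren_inj [].
    move=> v; rewrite flatten_cat mem_cat => /orP[/vercs [i' [v' [i's /ren_inj [_ E' _]]]]|].
      by rewrite E' i's in isn.
    rewrite /= mem_cat => /orP[/mapP[[|i'] _ //= /ren_inj [] //]|].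
    rewrite flatten_cat mem_cat => /orP[/verbs|]; last by rewrite inE.
    by move=> [//|[b' [i' [v' [b'Z /ren_inj [E' _ _]]]]]]; rewrite E' b'Z in bZ'.
  - move=> c; rewrite mem_cat => /orP[/mapP[c' c'ts ->]|/szcs //]; rewrite size_map; exact: szts.
  - move=> f; rewrite mem_cat => /orP[/mapP[g gt ->]|/covcs[c]]; last first.
      rewrite inE => /orP[/eqP ->|ccs] fc; first by exists pb; rewrite ?mem_head.
      by exists c => //; rewrite inE mem_cat ccs !orbT.
    have [g0|g0] := eqVneq g.2 [::]; first by exists pb; rewrite ?mem_head // g0.
    have [c] := covts g gt g0; rewrite mem_cat => /orP[cts gc|].
      exists (map (ren b i) c); first by rewrite inE mem_cat map_f ?orbT.
      by move=> _ /mapP[x /gc xc ->]; exact: map_f.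
    rewrite inE => /eqP -> gc; exists pb; first exact: mem_head.
    move=> y /mapP[x /gc xg ->]; move: xg; rewrite inE => /eqP ->; apply/mapP; exists i.+1 => //.
    by rewrite mem_iota /= add0n -(prednK k0) ltnS (leq_trans ib szb2).
  - move=> x; rewrite flatten_cat mem_cat => /orP[|/vercs [i' [v [i's ->]]]]; last first.
      by exists i', v; rewrite inE i's orbT.
    by rewrite -map_flatten => /mapP[v _ ->]; exists i, v; rewrite mem_head.
exists (cs ++ pb :: bs); split.
- by rewrite -catA.
- move=> c; rewrite mem_cat inE => /or3P[/szcs //|/eqP ->|/szbs //].
  by rewrite size_map size_iota.
- move=> f; rewrite !mem_cat => /orP[/orP[/mapP[g gb ->]|/covcs [c cc fc]]|fZ] f0.
  + exists pb; first by rewrite !(mem_cat, inE) eqxx !orbT.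
    move=> _ /mapP[x xg ->]; apply: map_f; rewrite mem_iota /=.
    by have /small_factsP [_] := b1 g gb; apply.
  + exists c => //; move: cc; rewrite !(mem_cat, inE) => /orP[/eqP ->|->] //.
    by rewrite eqxx !orbT.
  + have [c cb fc] := covbs f fZ f0; exists c => //; move: cb.
    by rewrite !(mem_cat, inE) => /orP[->|->]; rewrite !orbT.
- move=> x; rewrite flatten_cat mem_cat => /orP[/vercs [i [v [_ ->]]]|].
    by right; exists b, i, v; rewrite mem_head.
  rewrite /= mem_cat => /orP[/mapP[[|i] _ ->]|/verbs [|[b' [i [v [b'Z ->]]]]]]; [by left| |by left|].
    by right; exists b, i, 0; rewrite mem_head.
  by right; exists b', i, v; rewrite inE b'Z orbT.
Qed.

Lemma trees_rooted_forest j t : 0 < k -> t \in trees j -> rooted_forest t.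
Proof.
move=> k0; elim: j t => [|j IH] t /=.
  by rewrite inE => /eqP ->; exists [::]; split => //; split.
by move=> /mapP[Z /sublists_sub ZP ->]; exact: glue_rooted_forest IH ZP.
Qed.

Lemma trees_wf j t f : t \in trees j -> f \in t -> size f.2 = ar f.1.
Proof.
elim: j t f => [|j IH] t f /=; first by rewrite inE => /eqP ->.
move=> /mapP[Z /sublists_sub ZP ->] /glueP[b /ZP /bag_types_sub [b1 _ b2]].
move=> [[g /b1 /small_factsP [sz _] ->]|[i [g [ib gi ->]]]] /=; rewrite size_map //.
exact: IH (b2 _ (mem_nth _ ib)) gi.
Qed.

Variables (I : instance E) (G : seq (seq nat)).
Hypothesis I_wf : inst_wf ar I.
Hypothesis G_ok : forall e, e \in G -> uniq e /\ size e <= k.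

Definition bag_facts x e : facts :=
  [seq f <- small_facts | (f.1, map (nth 0 (x :: rem x e)) f.2) \in I].

(* The unravelling of [I] at [x] to depth [j] with one bag for each type; filtering a
   fixed list makes the result range over the finite list [trees j]. *)
Fixpoint tree j x : facts :=
  if j is j'.+1 then
    glue [seq b <- bag_types (trees j') |
      b \in [seq (bag_facts x e, map (tree j') (rem x e)) | e <- G & x \in e]]
  else [::].

Definition type_of j x e : bag_type := (bag_facts x e, map (tree j) (rem x e)).

Lemma tree_in j x : tree j x \in trees j.
Proof.
case: j => [|j] /=; first by rewrite inE.
by rewrite map_f // filter_sublists.
Qed.

Lemma type_in j x e : e \in G -> x \in e ->
  type_of j x e \in [seq b <- bag_types (trees j) | b \in [seq type_of j x e | e <- G & x \in e]].
Proof.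
move=> eG xe; rewrite mem_filter map_f ?mem_filter ?xe //=.
apply/allpairsP; exists (type_of j x e); split => //=; first exact: filter_sublists.
rewrite mem_seqs_upto size_map size_rem //; apply/andP; split.
  by have [_ le] := G_ok eG; rewrite -!subn1 leq_sub2r.
by apply/allP => _ /mapP[y _ ->]; exact: tree_in.
Qed.

Lemma tree_bag j x e f : e \in G -> x \in e -> f \in I -> {subset f.2 <= e} ->
  (f.1, map (fun y => pos (type_of j x e) (index y (x :: rem x e))) f.2) \in tree j.+1 x.
Proof.
move=> eG xe fI fe; have [ue sze] := G_ok eG.
have mem y : y \in e -> y \in x :: rem x e.
  by rewrite -(perm_mem (perm_to_rem xe)).
apply/glueP; exists (type_of j x e); first exact: type_in.
left; exists (f.1, map (index^~ (x :: rem x e)) f.2); last by rewrite /= -map_comp.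
rewrite mem_filter /= -map_comp map_id_in; last by move=> y yf; apply: nth_index; apply: mem; exact: fe.
have -> : (f.1, f.2) = f by case: (f).
rewrite fI; apply/small_factsP; split; first by rewrite size_map; exact: I_wf.
move=> _ /mapP[y /fe /mem yf ->]; apply: leq_trans sze.
by rewrite (perm_size (perm_to_rem xe)); move: yf; rewrite -index_mem.
Qed.

Lemma tree_child j x e y f : e \in G -> x \in e -> y \in e -> y <> x -> f \in tree j y ->
  (f.1, map (ren (type_of j x e) (index y (rem x e))) f.2) \in tree j.+1 x.
Proof.
move=> eG xe ye yx ft; apply/glueP; exists (type_of j x e); first exact: type_in.
right; have yr : y \in rem x e.
  by rewrite (mem_rem_uniq _ (proj1 (G_ok eG))) !inE ye andbT; apply/eqP.
exists (index y (rem x e)), f; split => //=; first by rewrite size_map index_mem.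
by rewrite (nth_map 0) ?index_mem // nth_index.
Qed.

(** An element encodes its path from the root as bag types and child indices. Folding replays the
    path along the first edge of each type; any such edge will do, since the type determines both
    the facts and the trees below. *)
Fixpoint fold_tree j x v : nat :=
  match j, v with
  | j'.+1, w.+1 =>
      if @unpickle (bag_type * nat * nat)%type w is Some (b, i, u) then
        let e := nth [::] [seq e <- G | x \in e]
                   (find (fun e => type_of j' x e == b) [seq e <- G | x \in e]) in
        fold_tree j' (nth 0 (rem x e) i) u
      else x
  | _, _ => x
  end.

Lemma fold_tree0 j x : fold_tree j x 0 = x. Proof. by case: j. Qed.

Lemma fold_tree_hom j x : hom (fold_tree j x) (tree j x) I.
Proof.
elim: j x => [|j IH] x // f /glueP[b]; rewrite mem_filter => /andP[/mapP[e0 e0G bE] _].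
set e := nth [::] [seq e <- G | x \in e] (find (fun e => type_of j x e == b) [seq e <- G | x \in e]).
have h : has (fun e => type_of j x e == b) [seq e <- G | x \in e].
  by apply/hasP; exists e0 => //; rewrite bE.
have te : type_of j x e = b by apply/eqP; exact: (nth_find [::] h).
have ren_E i u : fold_tree j.+1 x (ren b i u) = fold_tree j (nth 0 (rem x e) i) u.
  by rewrite /= pickleK.
move=> [[g]|[i [g [ib gi ->]]]].
  rewrite -{1}te mem_filter => /andP[/= gI _] ->.
  rewrite -[X in X \in I]/(g.1, map (fold_tree j.+1 x) (map (pos b) g.2)) -map_comp.
  suff <- : map (nth 0 (x :: rem x e)) g.2 = map (fold_tree j.+1 x \o pos b) g.2 by [].
  apply: eq_map => -[|i]; first by rewrite [RHS]fold_tree0.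
  by rewrite [RHS]/comp -[pos b i.+1]/(ren b i 0) ren_E fold_tree0.
rewrite -te /= size_map in ib gi; rewrite (nth_map 0) // in gi.
have := IH _ _ gi.
rewrite -[X in _ -> X \in I]/(g.1, map (fold_tree j.+1 x) (map (ren b i) g.2)) -map_comp.
suff -> : map (fold_tree j.+1 x \o ren b i) g.2 = map (fold_tree j (nth 0 (rem x e) i)) g.2 by [].
by apply: eq_map => u; rewrite [LHS]/comp ren_E.
Qed.
End Unravel.

(** * First-order rewritings *)

Section Ball.
Variables (E : finType) (ar : E -> nat) (k : nat) (I : instance E) (G : seq (seq nat)).
Hypothesis I_wf : inst_wf ar I.
Hypothesis G_ok : forall e, e \in G -> uniq e /\ size e <= k.
Hypothesis G_cover : forall f, f \in I -> exists2 e, e \in G & {subset f.2 <= e}.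
Variables (R c : nat).
Hypothesis gG : girth_gt R.*2.+2 G.

(** The distance from [c], with [R.+1] standing for everything beyond [R]. *)
Definition lev x := find (fun j => near G j c x) (iota 0 R.+1).

Lemma lev_le j x : j <= R -> near G j c x = (lev x <= j).
Proof.
move=> jR; apply/idP/idP => [nx|le].
  rewrite leqNgt; apply/negP => /(before_find 0).
  by rewrite nth_iota ?ltnS // add0n nx.
have lt : lev x < size (iota 0 R.+1) by rewrite size_iota ltnS (leq_trans le).
have := nth_find 0 (etrans (has_find _ _) lt).
rewrite -/(lev x) nth_iota; last by rewrite size_iota in lt.
by rewrite add0n; exact: near_mono.
Qed.

Lemma near_next j x y e : e \in G -> x \in e -> y \in e -> near G j c x -> near G j.+1 c y.
Proof. by move=> eG xe ye nx; rewrite -addn1; apply: near_trans nx (near_edge eG xe ye). Qed.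

Lemma lev_edge e x y : e \in G -> x \in e -> y \in e -> lev x < R -> lev y <= (lev x).+1.
Proof.
move=> eG xe ye lt; rewrite -lev_le //; apply: near_next eG xe ye _.
by rewrite lev_le // ltnW.
Qed.

Lemma lev0 x : lev x = 0 -> x = c.
Proof. by move=> l0; have := lev_le x (leq0n R); rewrite l0 leqnn /= => /eqP. Qed.

Lemma touched_mono F F' e u : {subset F <= F'} -> touched F e c u -> touched F' e c u.
Proof. by move=> sub [->|[e' [/sub e'F ne ue]]]; [left|right; exists e']. Qed.

(* Every edge of [F] has two vertices shared with the rest of [F], [c] and [x]:
   a shortest path from [c] to [x] is such an [F]. *)
Definition core (F : seq (seq nat)) x := forall e, e \in F -> exists u v,
  [/\ u \in e, v \in e, u <> v, touched F e c u \/ u = x & touched F e c v \/ v = x].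

(** The two bounds on levels serve to show that an edge added later is not on the path already. *)
Lemma shortest_path j x : j <= R -> lev x = j -> exists F,
  [/\ {subset F <= G} /\ size F <= j, forall e y, e \in F -> y \in e -> lev y <= j,
      forall e, e \in F -> exists2 z, z \in e & lev z < j,
      x = c \/ exists2 e, e \in F & x \in e & core F x].
Proof.
elim: j x => [|j IH] x jR lx; first by exists [::]; split => //; left; exact: lev0.
have : near G j.+1 c x by rewrite lev_le // lx.
rewrite /= lev_le ?(ltnW jR) // lx ltnn /= => /hasP[e eG /andP[xe /hasP[y ye]]].
rewrite lev_le ?(ltnW jR) // => yj.
have ly : lev y = j.
  apply/eqP; rewrite eqn_leq yj -ltnS -lx; apply: (lev_edge eG ye xe).
  exact: leq_ltn_trans yj jR.
have [F [[sF szF] hiF loF endF coreF]] := IH y (ltnW jR) ly.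
have eF : e \notin F.
  by apply/negP => /hiF /(_ xe); rewrite lx ltnn.
exists (e :: F); split.
- split=> //; by move=> e'; rewrite inE => /orP[/eqP ->|/sF].
- move=> e' z; rewrite inE => /orP[/eqP ->|e'F] ze; last by rewrite (leq_trans (hiF _ _ e'F ze)).
  by rewrite -ly; apply: (lev_edge eG ye ze); rewrite ly.
- move=> e'; rewrite inE => /orP[/eqP ->|/loF [z ze zj]]; first by exists y => //; rewrite ly.
  by exists z => //; rewrite ltnW.
- by right; exists e => //; rewrite mem_head.
move=> e'; rewrite inE => /orP[/eqP ->|e'F].
  exists x, y; split => //; [by move=> xy; move: lx; rewrite xy ly => /n_Sn|by right|left].
  case: endF => [->|[f fF yf]]; first by left.
  right; exists f; rewrite inE fF orbT; split => //.
  by move=> fe; rewrite -fe fF in eF.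
have [u [v [ue ve uv tu tv]]] := coreF e' e'F.
have sub : {subset F <= e :: F} by move=> f fF; rewrite inE fF orbT.
have up w : touched F e' c w \/ w = y -> touched (e :: F) e' c w \/ w = x.
  move=> [/(touched_mono sub)|->]; first by left.
  left; right; exists e; rewrite mem_head; split => // ee.
  by rewrite ee e'F in eF.
by exists u, v; split => //; exact: up.
Qed.

(** The centre [c] is the root in [girth_gt]. The bound admits two shortest paths of at most [R]
    edges each together with two further edges. *)
Lemma no_core F : {subset F <= G} -> F <> [::] -> size F <= R.*2.+2 ->
  (forall e, e \in F -> exists u v,
     [/\ u \in e, v \in e, u <> v, touched F e c u & touched F e c v]) -> False.
Proof.
move=> sF F0 szF H.
have sub : {subset F <= undup F} by move=> x; rewrite mem_undup.
have uF0 : undup F <> [::] by case: (F) F0 sub => // f F' _ /(_ f (mem_head _ _)); case: undup.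
have [||e eF] := @gG (undup F) c (undup_uniq _) _ uF0.
- by move=> x; rewrite mem_undup => /sF.
- exact: leq_trans (size_undup _) szF.
rewrite mem_undup in eF; have [u [v [ue ve uv tu tv]]] := H e eF.
by move=> /(_ u v ue ve (touched_mono sub tu) (touched_mono sub tv)).
Qed.

Lemma path_touched (F : seq (seq nat)) x e : x = c \/ (exists2 f, f \in F & x \in f) -> e \notin F ->
  touched F e c x.
Proof.
case=> [->|[f fF xf]] eF; first by left.
by right; exists f; split => // fe; rewrite -fe fF in eF.
Qed.

(** Otherwise [e] closes a cycle with the shortest paths to its two lowest vertices. *)
Lemma lowest_unique e x y : e \in G -> x \in e -> y \in e -> lev x = lev y -> lev x <= R ->
  (forall z, z \in e -> lev x <= lev z) -> x = y.
Proof.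
move=> eG xe ye xy xR low; apply: NNPP => ne.
have [F [[sF szF] _ loF endF coreF]] := shortest_path xR erefl.
have yR : lev y <= R by rewrite -xy.
have [F' [[sF' szF'] _ loF' endF' coreF']] := shortest_path yR erefl.
have eF : e \notin F by apply/negP => /loF [z /low]; rewrite leqNgt => /negP.
have eF' : e \notin F' by apply/negP => /loF' [z /low]; rewrite -xy leqNgt => /negP.
set K := e :: F ++ F'.
have s1 : {subset F <= K} by move=> f; rewrite inE mem_cat => ->; rewrite orbT.
have s2 : {subset F' <= K} by move=> f; rewrite inE mem_cat => ->; rewrite !orbT.
apply: (@no_core K) => //.
- by move=> f; rewrite inE mem_cat => /or3P[/eqP ->|/sF|/sF'].
- rewrite /= size_cat ltnS; apply: leq_trans (leqnSn _).
  by rewrite -addnn leq_add // ?(leq_trans szF) // (leq_trans szF') // -xy.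
move=> f; rewrite inE mem_cat => /or3P[/eqP ->|fF|fF'].
- exists x, y; split => //; first by apply: touched_mono s1 _; exact: path_touched endF eF.
  by apply: touched_mono s2 _; exact: path_touched endF' eF'.
- have [u [v [ue ve uv tu tv]]] := coreF f fF; exists u, v.
  have up w : touched F f c w \/ w = x -> touched K f c w.
    move=> [/(touched_mono s1) //|->]; right; exists e; rewrite mem_head; split => // ef.
    by rewrite ef fF in eF.
  by split => //; exact: up.
- have [u [v [ue ve uv tu tv]]] := coreF' f fF'; exists u, v.
  have up w : touched F' f c w \/ w = y -> touched K f c w.
    move=> [/(touched_mono s2) //|->]; right; exists e; rewrite mem_head; split => // ef.
    by rewrite ef fF' in eF'.
  by split => //; exact: up.
Qed.

(** Otherwise [e] and [f] meet in [x] and close a cycle with the shortest paths to [y] and [z]. *)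
Lemma parent_edge_unique e f x y z : e \in G -> f \in G -> x \in e -> x \in f -> y \in e ->
  z \in f -> lev x <= R -> lev x = (lev y).+1 -> lev x = (lev z).+1 -> e = f.
Proof.
move=> eG fG xe xf ye zf xR xy xz; apply: NNPP => ne.
have yR : lev y <= R by rewrite ltnW // -xy.
have zR : lev z <= R by rewrite ltnW // -xz.
have [F [[sF szF] hiF _ endF coreF]] := shortest_path yR erefl.
have [F' [[sF' szF'] hiF' _ endF' coreF']] := shortest_path zR erefl.
have eF : e \notin F by apply/negP => /hiF /(_ xe); rewrite xy ltnn.
have fF' : f \notin F' by apply/negP => /hiF' /(_ xf); rewrite xz ltnn.
set K := e :: f :: F ++ F'.
have s1 : {subset F <= K} by move=> g; rewrite !inE mem_cat => ->; rewrite !orbT.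
have s2 : {subset F' <= K} by move=> g; rewrite !inE mem_cat => ->; rewrite !orbT.
have eK : e \in K by rewrite mem_head.
have fK : f \in K by rewrite !inE eqxx orbT.
have neq_lev u v : lev u = (lev v).+1 -> u <> v by move=> uv E'; rewrite E' in uv; exact: n_Sn uv.
apply: (@no_core K) => //.
- by move=> g; rewrite !inE mem_cat => /or4P[/eqP ->|/eqP ->|/sF|/sF'].
- rewrite /= size_cat !ltnS -addnn leq_add // ?(leq_trans szF) // (leq_trans szF') //.
move=> g; rewrite !inE mem_cat => /or4P[/eqP ->|/eqP ->|gF|gF'].
- exists x, y; split => //; first exact: neq_lev.
    by right; exists f; split => // fe; apply: ne.
  by apply: touched_mono s1 _; exact: path_touched endF eF.
- exists x, z; split => //; first exact: neq_lev.
    by right; exists e; split => // fe; apply: ne.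
  by apply: touched_mono s2 _; exact: path_touched endF' fF'.
- have [u [v [ue ve uv tu tv]]] := coreF g gF; exists u, v.
  have up w : touched F g c w \/ w = y -> touched K g c w.
    move=> [/(touched_mono s1) //|->]; right; exists e; split => // eg.
    by rewrite eg gF in eF.
  by split => //; exact: up.
- have [u [v [ue ve uv tu tv]]] := coreF' g gF'; exists u, v.
  have up w : touched F' g c w \/ w = z -> touched K g c w.
    move=> [/(touched_mono s2) //|->]; right; exists f; split => // eg.
    by rewrite eg gF' in fF'.
  by split => //; exact: up.
Qed.

Definition par x :=
  nth [::] G (find (fun e => (x \in e) && has (fun y => (lev y).+1 == lev x) e) G).
Definition up x := nth 0 (par x) (find (fun y => (lev y).+1 == lev x) (par x)).

Lemma par_upP x : lev x <= R -> 0 < lev x ->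
  [/\ par x \in G, x \in par x, up x \in par x & lev x = (lev (up x)).+1].
Proof.
case lx : (lev x) => [//|j] jR _.
have [F [[sF _] _ loF endF _]] := shortest_path jR lx.
have : near G j.+1 c x by rewrite lev_le // lx.
rewrite /= lev_le ?(ltnW jR) // lx ltnn /= => /hasP[e eG /andP[xe /hasP[y ye]]].
rewrite lev_le ?(ltnW jR) // => yj.
have ly : lev y = j.
  apply/eqP; rewrite eqn_leq yj -ltnS -lx; apply: (lev_edge eG ye xe).
  exact: leq_ltn_trans yj jR.
have h : has (fun e => (x \in e) && has (fun y => (lev y).+1 == lev x) e) G.
  by apply/hasP; exists e => //; rewrite xe; apply/hasP; exists y => //; rewrite ly lx.
have := nth_find [::] h; rewrite -/(par x) => /andP[xp hp].
have := nth_find 0 hp; rewrite -/(up x) => /eqP lu; split; rewrite ?lu ?lx //.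
  by rewrite /par mem_nth // -has_find.
by rewrite /up mem_nth // -has_find.
Qed.

Lemma par_up e t y : e \in G -> t \in e -> y \in e -> lev y = (lev t).+1 -> lev y <= R ->
  par y = e /\ up y = t.
Proof.
move=> eG te ye yt yR; have [|pG yp upp ly] := par_upP yR; first by rewrite yt.
have pe : par y = e by apply: (parent_edge_unique pG eG yp ye upp te yR ly yt).
split => //; rewrite pe in upp; apply: (lowest_unique eG upp te).
- by apply: succn_inj; rewrite -ly.
- by rewrite ltnW // -ly.
move=> z ze; rewrite leqNgt -ltnS -ly; apply/negP => lt.
have lt' : (lev z).+1 < lev y by rewrite ly ltnS; move: lt; rewrite ly !ltnS.
have zR : lev z < R by rewrite (leq_trans (ltnW lt')).
by have := lev_edge eG ze ye zR; rewrite leqNgt lt'.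
Qed.

Notation tree := (tree ar k I G).
Notation type_of := (type_of ar k I G).

(** Places the subtree at a vertex [x] of level [n] inside the tree at [c] by climbing through
    parents. The parent has level [m] and a tree of depth [R.+1 - m], hence bag types built from
    trees of depth [R - m]. *)
Fixpoint emb n x : nat -> nat :=
  if n is m.+1 then
    emb m (up x) \o ren (type_of (R - m) (up x) (par x)) (index x (rem (up x) (par x)))
  else id.

Lemma emb_hom n x f : lev x = n -> n <= R -> f \in tree (R.+1 - n) x ->
  (f.1, map (emb n x) f.2) \in tree R.+1 c.
Proof.
elim: n x f => [|n IH] x f lx nR ft.
  by rewrite /= map_id; move: ft; rewrite (lev0 lx) subn0; case: (f).
have [||pG xp upp lu] := @par_upP x; rewrite ?lx //.
rewrite [map _ _]map_comp; apply: (IH (up x) (f.1, _)); rewrite ?(ltnW nR) //.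
  by apply: succn_inj; rewrite -lu.
rewrite subSn ?(ltnW nR) //; apply: (tree_child G_ok) => //.
by move=> E'; move: lu; rewrite -E' => /n_Sn.
Qed.

Definition ball_map x := emb (lev x) x 0.

(** The edge around [f] has a unique lowest vertex [t], and the other elements of [f] are one level
    up with this edge as parent edge, so they land in its bag at [t]. Depth [R.+1] leaves a bag even
    when [t] has level [R]. *)
Lemma ball_hom f : f \in I -> f.2 != [::] -> (forall x, x \in f.2 -> near G R c x) ->
  (f.1, map ball_map f.2) \in tree R.+1 c.
Proof.
move=> fI f0 fR; have [e eG fe] := G_cover fI.
have [x0 x0f] : exists x, x \in f.2 by case: (f.2) f0 => // x l _; exists x; exact: mem_head.
have [t te tmin] : exists2 t, t \in e & forall z, z \in e -> lev t <= lev z.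
  have ex : exists j, has (fun t => lev t == j) e by exists (lev x0); apply/hasP; exists x0; rewrite ?fe.
  case: (ex_minnP ex) => j /hasP[t te /eqP tj] jmin; exists t => // z ze.
  by rewrite tj; apply: jmin; apply/hasP; exists z.
have tR : lev t <= R by rewrite (leq_trans (tmin _ (fe _ x0f))) // -lev_le ?fR.
have ft := tree_bag I_wf G_ok (R - lev t) eG te fI fe.
have := emb_hom erefl tR _; rewrite subSn // => /(_ _ ft) /=; rewrite -map_comp.
suff -> : map ball_map f.2 = map (emb (lev t) t \o
    (fun y => pos (type_of (R - lev t) t e) (index y (t :: rem t e)))) f.2 by [].
apply/eq_in_map => y yf; rewrite /comp /ball_map.
have [->|/eqP ty] := eqVneq t y; first by rewrite /= eqxx.
have yR : lev y <= R by rewrite -lev_le ?fR.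
have ye := fe _ yf; have ly : lev y = (lev t).+1.
  apply/eqP; rewrite eqn_leq; apply/andP; split.
    have [lt|le] := ltnP (lev t) R; first exact: (lev_edge eG te ye lt).
    exact: leqW (leq_trans yR le).
  rewrite ltn_neqAle tmin // andbT; apply/eqP => E'; apply: ty.
  exact: (lowest_unique eG te ye E' tR tmin).
have [py uy] := par_up eG te ye ly yR.
by rewrite ly /= py uy (negPf (introN eqP ty)).
Qed.
End Ball.

(** * Disjoint unions of trees as queries *)

Section Union.
Variables (E : finType) (ar : E -> nat) (k : nat).
Local Notation facts := (seq (fact E)).

Definition tag_pt (t : facts) (v : nat) : nat := pickle (t, v).

Lemma tag_pt_inj t v t' v' : tag_pt t v = tag_pt t' v' -> t = t' /\ v = v'.
Proof. by move=> /(pcan_inj (@pickleK _)) [-> ->]. Qed.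

Definition disjoint_union (Z : seq facts) : facts :=
  flatten [seq map_facts (tag_pt t) t | t <- undup Z].

Lemma disjoint_unionP Z f : reflect (exists t g, [/\ t \in Z, g \in t &
  f = (g.1, map (tag_pt t) g.2)]) (f \in disjoint_union Z).
Proof.
apply: (iffP flatten_mapP) => [[t]|[t [g [tZ gt ->]]]].
  by rewrite mem_undup => tZ /mapP[g gt ->]; exists t, g.
by exists t; rewrite ?mem_undup //; apply/mapP; exists g.
Qed.

Lemma disjoint_union_treewidth (nulls : facts) Z : 0 < k \/ Z = [::] ->
  (forall f, f \in nulls -> f.2 = [::]) -> (forall t, t \in Z -> rooted_forest k t) ->
  has_treewidth 1 k (nulls ++ disjoint_union Z).
Proof.
move=> k0 n0 Zf.
suff [bs [fbs szbs covbs _]] : exists bs, [/\ forest bs, forall b, b \in bs -> size b <= k,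
    forall f, f \in disjoint_union Z -> f.2 != [::] -> exists2 b, b \in bs & {subset f.2 <= b} &
    forall x, x \in flatten bs -> exists t v, t \in undup Z /\ x = tag_pt t v].
  apply: (forest_treewidth fbs szbs) => f; rewrite mem_cat => /orP[/n0 ->//|]; exact: covbs.
have {}Zf : forall t, t \in undup Z -> rooted_forest k t by move=> t; rewrite mem_undup; exact: Zf.
have {}k0 : 0 < k \/ undup Z = [::] by case: k0 => [|->]; [left|right].
rewrite /disjoint_union; elim: (undup Z) (undup_uniq Z) k0 Zf => [|t Z' IH] uZ k0 Zf.
  by exists [::]; split.
have {}k0 : 0 < k by case: k0.
have [/= tZ' uZ'] := andP uZ.
have [|t' t'Z|bs [fbs szbs covbs verbs]] := IH uZ'; first by left.
  by apply: Zf; rewrite inE t'Z orbT.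
have [ts [fts szts covts]] := Zf t (mem_head _ _).
(* The root of [t] gets a singleton bag, in place of the closing bag [[:: 0]]; this uses [0 < k]. *)
pose X := [:: tag_pt t 0] :: bs.
have fX : forest X.
  by split=> // u v; rewrite !inE => /eqP -> /eqP ->.
exists (map (map (tag_pt t)) ts ++ X); split.
- apply: forest_graft => //; first by move=> u v /tag_pt_inj [].
  move=> v; rewrite /= inE => /orP[/eqP /tag_pt_inj [] //|/verbs [t' [v' [t'Z /tag_pt_inj [E' _]]]]].
  by rewrite E' t'Z in tZ'.
- move=> b; rewrite mem_cat inE => /or3P[/mapP[b' /szts sz ->]|/eqP -> //|/szbs //].
  by rewrite size_map.
- move=> f; rewrite mem_cat => /orP[/mapP[g gt ->]|fZ] f0.
    have [|b] := covts g gt; first by case: (g.2) f0.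
    rewrite mem_cat => /orP[bts gb|]; last rewrite inE => /eqP -> gb.
      exists (map (tag_pt t) b); first by rewrite mem_cat map_f.
      by move=> _ /mapP[x /gb xb ->]; exact: map_f.
    exists [:: tag_pt t 0]; first by rewrite mem_cat mem_head orbT.
    move=> y /mapP[x /gb xb ->]; move: xb; by rewrite !inE => /eqP ->.
  by have [b bbs fb] := covbs f fZ f0; exists b; rewrite // mem_cat inE bbs !orbT.
move=> x; rewrite flatten_cat mem_cat /= inE => /or3P[|/eqP ->|/verbs [t' [v [t'Z ->]]]].
- by rewrite -map_flatten => /mapP[v _ ->]; exists t, v; rewrite mem_head.
- by exists t, 0; rewrite mem_head.
- by exists t', v; rewrite inE t'Z orbT.
Qed.

Definition nullary_facts : facts := [seq (R, [::]) | R <- enum E & ar R == 0].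

Definition tree_cqs j : ucq E :=
  [seq nulls ++ disjoint_union Z | nulls <- sublists nullary_facts, Z <- sublists (trees ar k j)].

Lemma tree_cqs_ok j q : q \in tree_cqs j -> cq_wf ar q.
Proof.
move=> /allpairsP[[ns Z] /= [/sublists_sub nsP /sublists_sub ZP ->]] f.
rewrite mem_cat => /orP[/nsP /mapP[R]|/disjoint_unionP[t [g [/ZP tT gt ->]]]].
  by rewrite mem_filter => /andP[/eqP a0 _] -> /=.
by rewrite /= size_map; exact: (trees_wf tT gt).
Qed.
End Union.

Lemma In_filter_decide (T : Type) (P : T -> Prop) (s : seq T) x :
  List.In x (List.filter (fun x => decide (P x)) s) <-> List.In x s /\ P x.
Proof.
rewrite List.filter_In; split=> -[xs H]; split=> //; exact/decideP.
Qed.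

Section FORewriting.
Variables (E : finType) (ar : E -> nat).

Section Core.
Variables (Pi : program E) (k : nat) (f : fo E).
Hypotheses (Pi_wf : wf_mddlog ar Pi) (dk : diameter Pi <= k) (f_closed : fv f = [::]).
Hypothesis f_rw : is_rewriting ar (sentence_holds f) Pi.
Let R := 2 ^ qrank f.

(** Entailment travels along a homomorphism from [I'] into the pieces [PA], across the game to [PB],
    and along [ball_hom] to the trees; folding the trees and applying [pi] leads back to [I]. *)
Lemma bounded_obstruction I : inst_wf ar I -> prog_entails I Pi -> exists q,
  [/\ q \in tree_cqs ar k R.+1, cq_treewidth 1 k q, prog_entails q Pi & exists h, hom h q I].
Proof.
move=> I0wf HI0.
have [I' [G [pi [gG G_ok G_cover I'wf [hpi tr]]]]] := sparse_lift R.*2.+2 Pi_wf dk I0wf.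
have {tr HI0} HI := tr HI0.
pose nulls := [seq g <- nullary_facts ar | g \in I'].
have nullsP g : g \in nulls -> g \in I' /\ g.2 = [::].
  by rewrite mem_filter => /andP[gI /mapP[S _ gE]]; split=> //; rewrite gE.
have in_nulls S : (S, [::]) \in I' -> (S, [::]) \in nulls.
  move=> SI; rewrite mem_filter SI; apply/mapP; exists S => //.
  by rewrite mem_filter mem_enum andbT; have /= <- := I'wf _ SI.
suff [Z [ZP k0 HZ [h hh]]] : exists Z, [/\ Z \in sublists (trees ar k R.+1), 0 < k \/ Z = [::],
    prog_entails (nulls ++ disjoint_union Z) Pi & exists h, hom h (disjoint_union Z) I'].
  exists (nulls ++ disjoint_union Z); split=> //.
  - by apply/allpairsP; exists (nulls, Z); rewrite filter_sublists.
  - apply: disjoint_union_treewidth => // [g /nullsP [] //|t tZ].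
    case: k0 => [k0|Z0]; last by rewrite Z0 in tZ.
    by apply: (trees_rooted_forest k0); exact: (sublists_sub ZP tZ).
  exists (pi \o h) => g; rewrite map_comp => gq; apply: (hpi (g.1, map h g.2)).
  move: gq; rewrite mem_cat => /orP[/nullsP [gI g0]|/hh //].
  by case: g gI g0 => S ys /= gI ys0; subst ys.
(* With [k = 0] all edges are empty and [I'] has nullary facts only. *)
have [k0|k0] := posnP k.
  exists [::]; split; [|by right| |by exists id].
    by rewrite -(filter_pred0 (trees ar k R.+1)) filter_sublists.
  rewrite cats0; apply: (@entails_hom _ id I') => // g gI; rewrite map_id.
  have [e eG ge] := G_cover g gI; have [_] := G_ok e eG; rewrite k0 leqn0 => /nilP e0.
  have g0 : g.2 = [::] by case: (g.2) ge => // x l /(_ x (mem_head _ _)); rewrite e0.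
  by rewrite g0; apply: in_nulls; rewrite -g0; case: (g) gI.
pose D (i : option (nat * nat)) : pred nat :=
  if i is Some (c, _) then near G R c else predT.
have [n fn] : exists n, qrank f < n by exists (qrank f).+1.
(* The additional centre [0] keeps [PB] nonempty when [adom I'] is empty. *)
pose centers := 0 :: adom I'.
pose PB := [seq Some (c, j) | c <- centers, j <- iota 0 n].
pose PA := None :: PB.
have PBP c j : (Some (c, j) \in PB) = (c \in centers) && (j < n).
  apply/allpairsP/andP => [[[c' j'] [/= cc jn [-> ->]]]|[cc jn]].
    by move: jn; rewrite mem_iota.
  by exists (c, j); split; rewrite //= mem_iota.
have PB0 : PB != [::].
  suff : Some (0, 0) \in PB by case: (PB).
  by rewrite PBP mem_head (leq_ltn_trans _ fn).
have PB_some i : i \in PB -> exists c j, i = Some (c, j).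
  by move=> /allpairsP[[c j] [_ _ ->]]; exists c, j.
have fresh c (L : seq (option (nat * nat))) : size L < n ->
    exists2 j, j < n & Some (c, j) \notin L.
  move=> szL; apply: NNPP => no.
  have : size [seq Some (c, j) | j <- iota 0 n] <= size L.
    apply: uniq_leq_size; first by rewrite map_inj_uniq ?iota_uniq // => a b [].
    move=> i /mapP[j jn ->]; rewrite mem_iota /= in jn; apply: contraT => nL.
    by case: no; exists j.
  by rewrite size_map size_iota leqNgt szL.
have ext P : P = PA \/ P = PB -> extends I' G D (qrank f) n P PB.
  move=> PE i x d L iP xI dr szL.
  have [j jn jL] := fresh (if i is Some (c, _) then c else x) L szL.
  have [iPB|iN] : i \in PB \/ i = None.
    by case: PE iP => ->; [rewrite inE => /orP[/eqP ->|->]; [right|left]|left].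
    have [c [j0 iE]] := PB_some i iPB; subst i; exists (Some (c, j)); split=> //.
    by move: iPB; rewrite !PBP jn => /andP[->].
  (* A point [x] in the full copy [None] is answered at the centre of its own ball, which agrees
     with [None] up to distance [2 ^ d <= R]. *)
  subst i; exists (Some (x, j)); split=> //; first by rewrite PBP jn andbT inE xI orbT.
  by move=> y xy /=; rewrite (near_mono _ xy) // leq_exp2l.
have extBA : extends I' G D (qrank f) n PB PA.
  move=> i x d L iP xI dr szL.
  have [i' [i'P i'L i'D]] := ext PB (or_intror erefl) i x d L iP xI dr szL.
  by exists i'; split=> //; rewrite inE i'P orbT.
have pieces_wf P : inst_wf ar (pieces I' D P).
  move=> [S xs] /piecesP[i [ys [_ yI _ ->]]] /=; rewrite size_map; exact: (I'wf (S, ys)).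
have HB : prog_entails (pieces I' D PB) Pi.
  have /f_rw : inst_wf ar (pieces I' D PB) by exact: pieces_wf.
  move=> rwB; apply/rwB.
  have /f_rw rwA : inst_wf ar (pieces I' D PA) by exact: pieces_wf.
  have /rwA HA : prog_entails (pieces I' D PA) Pi.
    apply: (@entails_hom _ (@pt_code (option (nat * nat)) None) I') => // -[S ys] SI.
    apply/piecesP; exists None, ys; split=> //; exact: all_predT.
  apply: (game G_cover (D := D) (r := qrank f) (n := n) (d := qrank f) (V := [::]) _ _ _ extBA _ _ _ _ _ HA) => //.
  - by apply: ext; left.
  - by rewrite f_closed.
  - exact: ltnW.
  - by exists (fun=> None), (fun=> None), id; split.
pose tr c := tree ar k I' G R.+1 c.
pose Z := [seq t <- trees ar k R.+1 | t \in map tr centers].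
exists Z; split; first exact: filter_sublists.
- by left.
- pose h u := if @unpickle (option (nat * nat) * nat)%type u is Some (Some (c, _), x)
    then tag_pt (tr c) (ball_map ar k I' G R c x) else 0.
  apply: (entails_hom (h := h)) HB => -[S xs] /piecesP[i [ys [iP yI yD ->]]] /=.
  case: ys yI yD => [|y ys] yI yD; first by rewrite mem_cat in_nulls.
  have [c [j iE]] := PB_some i iP; subst i.
  rewrite mem_cat; apply/orP; right; apply/disjoint_unionP.
  exists (tr c), (S, map (ball_map ar k I' G R c) (y :: ys)); split=> //.
  + rewrite mem_filter tree_in andbT; apply: map_f.
    by move: iP; rewrite PBP => /andP[].
  + apply: (@ball_hom _ ar k I' G I'wf G_ok G_cover R c gG (S, y :: ys)) => // x.
    exact: (allP yD).
  + congr pair; rewrite -!map_comp; apply: eq_map => x /=.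
    by rewrite /h /pt_code pickleK.
pose h u := if @unpickle (seq (fact E) * nat)%type u is Some (t, v)
  then fold_tree ar k I' G R.+1 (nth 0 centers (find (fun c => tr c == t) centers)) v else 0.
exists h => g /disjoint_unionP[t [g' [tZ gt ->]]] /=.
set c := nth 0 centers (find (fun c => tr c == t) centers).
have tc : tr c = t.
  have hc : has (fun c => tr c == t) centers.
    by move: tZ; rewrite mem_filter => /andP[/mapP[c' cc ->] _]; apply/hasP; exists c'.
  by apply/eqP; exact: (nth_find 0 hc).
have := fold_tree_hom (ar := ar) (k := k) (I := I') (G := G) (j := R.+1) (x := c).
rewrite -/(tr c) tc => /(_ _ gt); rewrite -map_comp.
suff -> : map (h \o tag_pt t) g'.2 = map (fold_tree ar k I' G R.+1 c) g'.2 by [].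
by apply: eq_map => v /=; rewrite /h /tag_pt pickleK.
Qed.
End Core.

(** Keeping only the queries that entail [Pi] as instances makes each disjunct sound, since
    entailment is preserved by homomorphisms. *)
Theorem fo_treelike_ucq (Pi : program E) k : wf_mddlog ar Pi -> diameter Pi = k ->
  FO_rewritable ar Pi ->
     exists Q : ucq E,
       (forall q, List.In q Q -> cq_wf ar q /\ cq_treewidth 1 k q) /\
       is_rewriting ar (ucq_holds Q) Pi.
Proof.
move=> wf dk [f [fc frw]]; have dk' : diameter Pi <= k by rewrite dk.
exists (List.filter (fun q => decide (cq_treewidth 1 k q /\ prog_entails q Pi))
  (tree_cqs ar k (2 ^ qrank f).+1)); split.
  by move=> q /In_filter_decide [/InP /tree_cqs_ok qwf [tw _]].
move=> I Iwf; split=> [[q [/In_filter_decide [_ [_ Hq]] [s sP]]]|HI].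
  by apply: entails_hom Hq; exact: sP.
have [q [qT tw Hq [h hh]]] := bounded_obstruction wf dk' fc frw Iwf HI.
exists q; split; first by apply/In_filter_decide; split=> //; exact/InP.
by exists h.
Qed.
End FORewriting.

Theorem theorem5p1 (E : finType) (ar : E -> nat) (Pi : program E) (k : nat) :
  wf_mddlog ar Pi -> diameter Pi = k ->
  (FO_rewritable ar Pi ->
     exists Q : ucq E,
       (forall q, List.In q Q -> cq_wf ar q /\ cq_treewidth 1 k q) /\
       is_rewriting ar (ucq_holds Q) Pi) /\
  (MDLog_rewritable ar Pi ->
     exists Pi' : program E,
       wf_mdlog ar Pi' /\ diameter Pi' <= k /\
       is_rewriting ar (fun I => prog_entails I Pi') Pi).
Proof.
by move=> wf dk; split; [exact: fo_treelike_ucq|exact: mdlog_narrow].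
Qed.
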